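(* Let $V$ be a smooth 3-manifold with a smooth volume form $d\mathrm{vol}$, let $\xi\subset TV$ be a contact structure on $V$, and let $\underline{W}$ be a nowhere vanishing vector field on $V$ which is Legendrian (tangent to $\xi$) and preserves $d\mathrm{vol}$, such that the closed 2-form $\omega=\iota_{\underline W}\,d\mathrm{vol}$ represents an integral class, i.e. $[\omega]$ lies in $H^2(V;\mathbb{Z})/\mathrm{Torsion}\subset H^2(V;\mathbb{R})$. Let $\pi:M^4\to V^3$ be a pre-quantum $S^1$-bundle with connection $\nabla$ for $\omega$, and let $H_\nabla\subset TM$ be the horizontal hyperplane field of $\nabla$. Then: 1) The plane field $\mathcal{D}$ on $M$ defined by $\mathcal{D}_m=(H_\nabla)_m\cap (D\pi_m)^{-1}(\xi_{\pi(m)})$ for $m\in M$ is an Engel structure. 2) The even contact structure $\mathcal{E}=[\mathcal{D},\mathcal{D}]$ of $\mathcal{D}$ is exactly the horizontal distribution $H_\nabla$, and the Cauchy characteristic $\mathcal{W}$ of $\mathcal{D}$ is the horizontal lift $H_\nabla\cap (D\pi)^{-1}\langle\underline W\rangle$ of the line field $\langle\underline W\rangle$.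
   Context: All objects are smooth. Distributions are identified with their sheaves of local sections; $[\mathcal A,\mathcal B]$ denotes the distribution spanned by brackets of local sections (one has $\mathcal A\subset[\mathcal A,\mathcal A]$ in this convention). An Engel structure on a 4-manifold $M$ is a rank 2 distribution $\mathcal{D}$ such that $\mathcal{E}=[\mathcal{D},\mathcal{D}]$ has constant rank 3 and $[\mathcal{E},\mathcal{E}]=TM$. The rank 3 distribution $\mathcal{E}$ is called its even contact structure. The Cauchy characteristic $\mathcal{W}$ is the line field $\mathcal{W}\subset\mathcal{E}$ which annihilates the bracket $\mathcal{E}\otimes\mathcal{E}\to TM/\mathcal{E}$, i.e. $[\mathcal{W},\mathcal{E}]\subset\mathcal{E}$; automatically $\mathcal{W}\subset\mathcal{D}$. Pre-quantum bundle: given a closed 2-form $\omega$ on $V$ whose class is the real image of an integral class $\alpha\in H^2(V;\mathbb{Z})$, a pre-quantum $S^1$-bundle for $\omega$ is a principal $S^1$-bundle ($S^1=\mathbb{R}/2\pi\mathbb{Z}$) $\pi:M\to V$ with Euler class $\alpha$, together with an $S^1$-connection $\nabla$ whose curvature 2-form is exactly $2\pi\omega$ (such a bundle and connection always exist). $H_\nabla$ is the kernel of the connection 1-form. *)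

(* Defs.v *)
From HB Require Import structures.
From mathcomp Require Import all_boot all_order all_algebra.
From mathcomp Require Import all_classical all_reals all_analysis.

Set Implicit Arguments.
Unset Strict Implicit.
Unset Printing Implicit Defensive.

Import Order.TTheory GRing.Theory Num.Theory.
Import numFieldNormedType.Exports.
Local Open Scope classical_set_scope.
Local Open Scope ring_scope.

Fixpoint Ck (R : realType) (n : nat) (W : normedModType R) (k : nat)
    (U : set 'rV[R]_n) (f : 'rV[R]_n -> W) : Prop :=
  match k with
  | 0 => forall x, U x -> {for x, continuous f}
  | k'.+1 => (forall x, U x -> differentiable f x) /\
             (forall v, Ck k' U (fun x => 'D_v f x))
  end.

(* Only meaningful for open [U]: [f] is total and its values outside [U] are
   ignored. *)
Definition Cinfty (R : realType) (n : nat) (W : normedModType R)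
    (U : set 'rV[R]_n) (f : 'rV[R]_n -> W) : Prop :=
  forall k, Ck k U f.

Record chart (R : realType) (T : Type) (n : nat) := Chart {
  cdom : set T;
  cfwd : T -> 'rV[R]_n;
  cinv : 'rV[R]_n -> T }.

Definition cimg (R : realType) (T : Type) (n : nat) (c : chart R T n) :
  set 'rV[R]_n := cfwd c @` cdom c.

Record is_chart (R : realType) (T : topologicalType) (n : nat)
    (c : chart R T n) : Prop := IsChart {
  cdom_open : open (cdom c);
  cimg_open : open (cimg c);
  cfwdK : forall p, cdom c p -> cinv c (cfwd c p) = p;
  cfwd_continuous : forall p, cdom c p -> {for p, continuous (cfwd c)};
  cinv_continuous : forall x, cimg c x -> {for x, continuous (cinv c)} }.

Record manifold (R : realType) (n : nat) := Manifold {
  mcarrier :> topologicalType;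
  matlas : set (chart R mcarrier n);
  m_hausdorff : hausdorff_space mcarrier;
  m_second_countable : @second_countable mcarrier;
  m_charts : forall c, matlas c -> is_chart c;
  m_cover : forall p, exists2 c, matlas c & cdom c p;
  m_compat : forall c d, matlas c -> matlas d ->
    Cinfty (cfwd c @` (cdom c `&` cdom d)) (cfwd d \o cinv c) }.

Definition smooth_on (R : realType) (n : nat) (M : manifold R n)
    (U : set M) (f : M -> R) : Prop :=
  open U /\ forall c, matlas c ->
    Cinfty (cfwd c @` (cdom c `&` U)) (f \o cinv c : 'rV[R]_n -> R^o).

Definition smooth_near (R : realType) (n : nat) (M : manifold R n)
    (p : M) (f : M -> R) : Prop :=
  exists2 U : set M, smooth_on U f & U p.

(* Continuity is included: [smooth_on] carries the openness of the domain,
   and constant functions are smooth on every open [B]. *)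
Definition smooth_map_on (R : realType) (m n : nat) (M : manifold R m)
    (N : manifold R n) (U : set M) (F : M -> N) : Prop :=
  forall (B : set N) (f : N -> R),
    smooth_on B f -> smooth_on (U `&` F @^-1` B) (f \o F).

(* A tangent vector at [p] is an operator on functions which are smooth near
   [p]. Operators are total on [M -> R], with value 0 on functions that are
   not smooth near [p]; with this normalization, equality of operators is
   equality of tangent vectors. *)
Definition oper (R : realType) (n : nat) (M : manifold R n) := (M -> R) -> R.

Definition germ_oper (R : realType) (n : nat) (M : manifold R n) (p : M)
    (v : oper M) : oper M :=
  fun f => if `[< smooth_near p f >] then v f else 0.

Definition ozero (R : realType) (n : nat) (M : manifold R n) : oper M :=
  fun _ => 0.
Arguments ozero {R n} M _.

Definition lincomb (R : realType) (n : nat) (M : manifold R n) (k : nat)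
    (a : 'I_k -> R) (v : 'I_k -> oper M) : oper M :=
  fun f => \sum_(i < k) a i * v i f.

(* T_p M: the operators \sum_i u_i d/dx_i at [p] in the coordinates of some
   chart around [p]. *)
Definition tangent (R : realType) (n : nat) (M : manifold R n) (p : M) :
    set (oper M) :=
  [set v | exists c : chart R M n, exists u : 'rV[R]_n,
     [/\ matlas c, cdom c p &
      v = germ_oper p
            (fun f => 'D_u (f \o cinv c : 'rV[R]_n -> R^o) (cfwd c p))]].

Definition vfield_on (R : realType) (n : nat) (M : manifold R n)
    (U : set M) (X : M -> oper M) : Prop :=
  [/\ open U, (forall p, U p -> tangent p (X p)) &
   forall (B : set M) (f : M -> R), B `<=` U -> smooth_on B f ->
     smooth_on B (fun p => X p f)].

Definition lie_bracket (R : realType) (n : nat) (M : manifold R n)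
    (X Y : M -> oper M) (p : M) : oper M :=
  germ_oper p (fun f => X p (fun q => Y q f) - Y p (fun q => X q f)).

Definition pushforward (R : realType) (m n : nat) (M : manifold R m)
    (N : manifold R n) (F : M -> N) (p : M) (v : oper M) : oper N :=
  germ_oper (F p) (fun f => v (f \o F)).

(* Pointwise families of sets of operators; [is_distribution k] says that such
   a family is a smooth rank-k subbundle of the tangent bundle. *)
Definition distr (R : realType) (n : nat) (M : manifold R n) :=
  M -> set (oper M).

Definition is_distribution (R : realType) (n : nat) (M : manifold R n)
    (k : nat) (D : distr M) : Prop :=
  forall p : M, exists U : set M, exists X : 'I_k -> M -> oper M,
    [/\ U p, (forall i, vfield_on U (X i)) &
     forall q, U q ->
       (forall a : 'I_k -> R, lincomb a (X ^~ q) = ozero M ->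
          forall i, a i = 0) /\
       D q = [set v | exists a : 'I_k -> R, v = lincomb a (X ^~ q)]].

Definition section_on (R : realType) (n : nat) (M : manifold R n)
    (U : set M) (D : distr M) (X : M -> oper M) : Prop :=
  vfield_on U X /\ forall p, U p -> D p (X p).

Definition lin_span (R : realType) (n : nat) (M : manifold R n)
    (S : set (oper M)) : set (oper M) :=
  [set v | exists k, exists a : 'I_k -> R, exists w : 'I_k -> oper M,
     (forall i, S (w i)) /\ v = lincomb a w].

Definition bracket_distr (R : realType) (n : nat) (M : manifold R n)
    (A B : distr M) : distr M :=
  fun p => lin_span [set w | exists U : set M, exists X Y : M -> oper M,
    [/\ U p, section_on U A X, section_on U B Y & w = lie_bracket X Y p]].

Definition engel (R : realType) (M : manifold R 4) (D : distr M) : Prop :=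
  let E := bracket_distr D D in
  [/\ is_distribution 2 D, is_distribution 3 E &
   forall p, bracket_distr E E p = tangent p].

Definition cauchy_characteristic (R : realType) (n : nat) (M : manifold R n)
    (E L : distr M) : Prop :=
  [/\ is_distribution 1 L, (forall p, L p `<=` E p) &
   forall p, bracket_distr L E p `<=` E p].

(* Values of forms on operators that are not tangent vectors are ignored. *)
Definition form1 (R : realType) (n : nat) (M : manifold R n) :=
  M -> oper M -> R.
Definition form2 (R : realType) (n : nat) (M : manifold R n) :=
  M -> oper M -> oper M -> R.
Definition form3 (R : realType) (n : nat) (M : manifold R n) :=
  M -> oper M -> oper M -> oper M -> R.

Definition tlinear (R : realType) (n : nat) (M : manifold R n) (p : M)
    (l : oper M -> R) : Prop :=
  forall (a : R) (v w : oper M), tangent p v -> tangent p w ->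
    l (fun f => a * v f + w f) = a * l v + l w.

Definition is_form1_on (R : realType) (n : nat) (M : manifold R n)
    (U : set M) (a : form1 M) : Prop :=
  [/\ open U, (forall p, U p -> tlinear p (a p)) &
   forall (B : set M) X, B `<=` U -> vfield_on B X ->
     smooth_on B (fun p => a p (X p))].

Definition is_form3 (R : realType) (n : nat) (M : manifold R n)
    (b : form3 M) : Prop :=
  [/\ forall p v w, tangent p v -> tangent p w ->
        [/\ tlinear p (fun u => b p u v w), tlinear p (fun u => b p v u w) &
            tlinear p (fun u => b p v w u)],
      forall p v w, tangent p v -> tangent p w ->
        [/\ b p v v w = 0, b p v w w = 0 & b p v w v = 0] &
      forall (B : set M) X Y Z,
        vfield_on B X -> vfield_on B Y -> vfield_on B Z ->
        smooth_on B (fun p => b p (X p) (Y p) (Z p))].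

Definition volume_form (R : realType) (M : manifold R 3) (b : form3 M) :
    Prop :=
  is_form3 b /\
  forall p, exists u v w : oper M,
    [/\ tangent p u, tangent p v, tangent p w & b p u v w != 0].

(* Convention without the factor 1/2. *)
Definition ext_deriv1 (R : realType) (n : nat) (M : manifold R n)
    (a : form1 M) (X Y : M -> oper M) (p : M) : R :=
  X p (fun q => a q (Y q)) - Y p (fun q => a q (X q))
  - a p (lie_bracket X Y p).

Definition d1_eq_on (R : realType) (n : nat) (M : manifold R n) (U : set M)
    (a : form1 M) (b : form2 M) : Prop :=
  forall (B : set M) X Y, B `<=` U -> vfield_on B X -> vfield_on B Y ->
    forall p, B p -> ext_deriv1 a X Y p = b p (X p) (Y p).

(* The value of a /\ da on (X, Y, Z) at p. *)
Definition wedge_ad (R : realType) (n : nat) (M : manifold R n)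
    (a : form1 M) (X Y Z : M -> oper M) (p : M) : R :=
  a p (X p) * ext_deriv1 a Y Z p + a p (Y p) * ext_deriv1 a Z X p
  + a p (Z p) * ext_deriv1 a X Y p.

Definition contact_structure (R : realType) (V : manifold R 3)
    (xi : distr V) : Prop :=
  forall p : V, exists U : set V, exists a : form1 V,
    [/\ U p, is_form1_on U a,
     (forall q, U q -> xi q = [set v | tangent q v /\ a q v = 0]) &
     forall q, U q -> exists B : set V, exists X Y Z : V -> oper V,
       [/\ B q, B `<=` U,
           [/\ vfield_on B X, vfield_on B Y & vfield_on B Z] &
           wedge_ad a X Y Z q != 0]].

(* The Lie derivative L_W b vanishes. *)
Definition preserves_form3 (R : realType) (n : nat) (M : manifold R n)
    (W : M -> oper M) (b : form3 M) : Prop :=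
  forall (U : set M) X Y Z,
    vfield_on U X -> vfield_on U Y -> vfield_on U Z ->
    forall p, U p ->
      W p (fun q => b q (X q) (Y q) (Z q))
      - b p (lie_bracket W X p) (Y p) (Z p)
      - b p (X p) (lie_bracket W Y p) (Z p)
      - b p (X p) (Y p) (lie_bracket W Z p) = 0.

Definition contraction3 (R : realType) (n : nat) (M : manifold R n)
    (W : M -> oper M) (b : form3 M) : form2 M :=
  fun p v w => b p (W p) v w.

Definition open_cover (T : topologicalType) (I : Type) (U : I -> set T) :
    Prop :=
  (forall i, open (U i)) /\ forall x, exists i, U i x.

(* A Cech 2-cocycle with values in the constant sheaf Z. Two such data may
   define the same class of H^2(V; Z); all uses below are invariant under
   refinement of the cover and change of the cocycle by a coboundary. *)
Record cech2 (T : topologicalType) := Cech2 {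
  cech_index : Type;
  cech_cover : cech_index -> set T;
  cech_val : cech_index -> cech_index -> cech_index -> T -> int;
  cech_coverP : open_cover cech_cover;
  cech_locconst : forall i j k x,
    cech_cover i x -> cech_cover j x -> cech_cover k x ->
    \forall y \near x, cech_val i j k y = cech_val i j k x;
  cech_cocycle : forall i j k l x,
    cech_cover i x -> cech_cover j x -> cech_cover k x -> cech_cover l x ->
    cech_val j k l x - cech_val i k l x + cech_val i j l x
    - cech_val i j k x = 0 }.

Definition refinement (T : topologicalType) (al : cech2 T) (J : Type)
    (U : J -> set T) (r : J -> cech_index al) : Prop :=
  open_cover U /\ forall j, U j `<=` cech_cover (r j).

(* The de Rham class of [omega] is the image of the class of [al] in
   H^2(V; R), through the Cech-de Rham zigzag
     omega = d lam_i,  lam_j - lam_i = d f_ij,  f_jk - f_ik + f_ij = al_ijk.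
   Allowing a refinement makes this depend only on the two classes: a real
   Cech coboundary can be absorbed in the f_ij. *)
Definition real_image (R : realType) (n : nat) (V : manifold R n)
    (al : cech2 V) (omega : form2 V) : Prop :=
  exists (J : Type) (U : J -> set V) (r : J -> cech_index al)
         (lam : J -> form1 V) (f : J -> J -> V -> R),
    [/\ refinement U r,
        (forall i, is_form1_on (U i) (lam i) /\ d1_eq_on (U i) (lam i) omega),
        (forall i j, smooth_on (U i `&` U j) (f i j) /\
           forall x v, U i x -> U j x -> tangent x v ->
             lam j x v - lam i x v = v (f i j)) &
        forall i j k x, U i x -> U j x -> U k x ->
          f j k x - f i k x + f i j x = (cech_val (r i) (r j) (r k) x)%:~R].

Definition integral_form (R : realType) (n : nat) (V : manifold R n)
    (omega : form2 V) : Prop :=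
  exists al : cech2 V, real_image al omega.

(* An action of S^1 = R / 2 pi Z, written as a 2pi-periodic action of R.
   Joint smoothness of (t, m) |-> rho t m is expressed in the coordinates
   (t, x) of R x M given by a chart of M. *)
Definition circle_action (R : realType) (n : nat) (M : manifold R n)
    (rho : R -> M -> M) : Prop :=
  [/\ forall m, rho 0 m = m,
      forall s t m, rho (s + t) m = rho s (rho t m),
      forall m, rho (pi *+ 2) m = m &
      forall (B : set M) (f : M -> R) (c : chart R M n),
        smooth_on B f -> matlas c ->
        let F (y : 'rV[R]_(1 + n)) :=
          rho (lsubmx y ord0 ord0) (cinv c (rsubmx y)) in
        let U := [set y | cimg c (rsubmx y) /\ B (F y)] in
        open U /\ Cinfty U (f \o F : 'rV[R]_(1 + n) -> R^o)].

(* A local trivialization over [U]: [sg] is a section, and [(co, si)] is the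
   S^1-component, with S^1 seen as the unit circle of R^2. Thus
   (x, t) |-> rho t (sg x) is an equivariant diffeomorphism from U x S^1 onto
   prj^-1 U, with smooth inverse (prj, (co, si)). *)
Definition trivialization (R : realType) (m n : nat) (M : manifold R m)
    (V : manifold R n) (prj : M -> V) (rho : R -> M -> M) (U : set V)
    (sg : V -> M) (co si : M -> R) : Prop :=
  [/\ smooth_map_on U sg /\ (forall x, U x -> prj (sg x) = x),
      smooth_on (prj @^-1` U) co /\ smooth_on (prj @^-1` U) si,
      (forall p, U (prj p) -> exists t, p = rho t (sg (prj p))) &
      forall x t, U x -> co (rho t (sg x)) = cos t /\
                         si (rho t (sg x)) = sin t].

Definition principal_circle_bundle (R : realType) (m n : nat)
    (M : manifold R m) (V : manifold R n) (prj : M -> V)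
    (rho : R -> M -> M) : Prop :=
  [/\ smooth_map_on setT prj, circle_action rho,
      (forall t p, prj (rho t p) = prj p) &
      forall x : V, exists U : set V, exists sg : V -> M,
        exists co si : M -> R,
        [/\ open U, U x & trivialization prj rho U sg co si]].

(* Local sections related by sg_j = sg_i . theta_ij have
   theta_jk - theta_ik + theta_ij in 2 pi Z; this Cech cocycle, divided by
   2 pi, represents the Euler class. With this sign the Euler class is the
   class of F / 2 pi, F the curvature of any connection. *)
Definition euler_class (R : realType) (m n : nat) (M : manifold R m)
    (V : manifold R n) (prj : M -> V) (rho : R -> M -> M) (al : cech2 V) :
    Prop :=
  exists (J : Type) (U : J -> set V) (r : J -> cech_index al)
         (sg : J -> V -> M) (theta : J -> J -> V -> R),
    [/\ refinement U r,
        (forall i, smooth_map_on (U i) (sg i) /\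
           forall x, U i x -> prj (sg i x) = x),
        (forall i j, smooth_on (U i `&` U j) (theta i j) /\
           forall x, U i x -> U j x ->
             sg j x = rho (theta i j x) (sg i x)) &
        forall i j k x, U i x -> U j x -> U k x ->
          theta j k x - theta i k x + theta i j x =
          pi *+ 2 * (cech_val (r i) (r j) (r k) x)%:~R].

Definition fundamental_field (R : realType) (n : nat) (M : manifold R n)
    (rho : R -> M -> M) (p : M) : oper M :=
  germ_oper p (fun f => derive1 (fun t : R => f (rho t p) : R^o) 0).

(* Lie(S^1) is identified with R so that exp : R -> R / 2 pi Z is the
   projection. *)
Definition connection_form (R : realType) (n : nat) (M : manifold R n)
    (rho : R -> M -> M) (A : form1 M) : Prop :=
  [/\ is_form1_on setT A,
      (forall p, A p (fundamental_field rho p) = 1) &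
      forall t p v, tangent p v ->
        A (rho t p) (pushforward (rho t) p v) = A p v].

(* The structure group is abelian, so the curvature of [A] is the 2-form [F]
   on the base with dA = prj^* F. *)
Definition curvature_form (R : realType) (m n : nat) (M : manifold R m)
    (V : manifold R n) (prj : M -> V) (A : form1 M) (F : form2 V) : Prop :=
  d1_eq_on setT A
    (fun p v w => F (prj p) (pushforward prj p v) (pushforward prj p w)).

Definition prequantum_bundle (R : realType) (m n : nat) (M : manifold R m)
    (V : manifold R n) (prj : M -> V) (rho : R -> M -> M) (A : form1 M)
    (omega : form2 V) : Prop :=
  principal_circle_bundle prj rho /\
  (exists al : cech2 V, real_image al omega /\ euler_class prj rho al) /\
  connection_form rho A /\
  curvature_form prj A (fun x v w => pi *+ 2 * omega x v w).

Definition horizontal (R : realType) (n : nat) (M : manifold R n)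
    (A : form1 M) : distr M :=
  fun p => [set v | tangent p v /\ A p v = 0].

Definition horizontal_lift (R : realType) (m n : nat) (M : manifold R m)
    (V : manifold R n) (prj : M -> V) (A : form1 M) (xi : distr V) : distr M :=
  fun p => horizontal A p `&` [set v | xi (prj p) (pushforward prj p v)].

Definition line_field (R : realType) (n : nat) (M : manifold R n)
    (W : M -> oper M) : distr M :=
  fun p => [set v | exists a : R, v = fun f => a * W p f].

(* Main.v *)
From mathcomp Require Import all_boot all_order all_algebra.
From mathcomp Require Import all_classical all_reals all_analysis.
From mathcomp Require Import ring lra.
Require Import Defs.

(** Write W~, Z~, T~ for the horizontal lifts to M of vector fields W, Z, T of V.
Everything follows from one identity: for horizontal fields X and Y, the
exterior derivative of the connection form A gives A([X, Y]) = - dA(X, Y), and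
the curvature condition turns this into
- 2 pi dvol(W, dprj X, dprj Y) ([connection_bracket]).  A bracket of horizontal
fields is thus horizontal exactly where W, dprj X and dprj Y are linearly
dependent.

Near any point of V, W can be completed by a section Z of xi and a field T into
a frame, with xi spanned by W and Z, and the contact condition says that
[W, Z] is not in xi ([contact_frame]).  Since W lies in the plane field xi,
dvol(W, ., .) vanishes on xi, so brackets of sections of D stay horizontal.
Conversely [W~, Z~] is horizontal and projects to [W, Z]; as W, Z and [W, Z]
span TV, the fields W~, Z~ and [W~, Z~] span the horizontal distribution
([bracket_engel]).  This gives E = [D, D] = H.  The bracket [Z~, T~] is not
horizontal because dvol(W, Z, T) is nonzero, hence [H, H] = TM
([bracket_horizontal_tangent]).  Finally, a line field L in H satisfies
[L, H] in H iff dvol(W, dprj L, .) vanishes on TV, that is, iff dprj L is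
spanned by W ([cauchy_characteristicP]).

Most of the text builds the differential geometry behind these few lines.
Tangent vectors are operators of the form of a directional derivative in some
chart.  The chain rule [tangent_chain] shows that every chart then represents
them, which makes T_p M a vector space with the coordinate derivatives as a
basis.  Brackets of vector fields are again tangent vectors because second
derivatives commute ([schwarz]).  Smoothness of all the fields constructed
comes from Cramer's formula: the inverse of a smooth invertible matrix is
smooth ([smooth_invmx]); this gives smooth coefficients in a frame
([frame_coef]) and smooth horizontal lifts ([horizontal_lift_vfield]).  Lifts
exist and are unique because prj is a submersion, as it has a local section
through every point ([prj_submersion]), so that its kernel is a line, which
is spanned by the fundamental field, where A takes the value 1
([horizontal_inj]). *)

Set Implicit Arguments.
Unset Strict Implicit.
Unset Printing Implicit Defensive.

Import Order.TTheory GRing.Theory Num.Theory.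
Import numFieldNormedType.Exports.
Local Open Scope classical_set_scope.
Local Open Scope ring_scope.

(** * Calculus of functions of class C^k on open subsets of R^n *)

(** The first-order expansion that characterizes the differential only involves
the germ of the function. *)
Lemma near_eq_differentiable (R : numFieldType) (V W : normedModType R)
    (f g : V -> W) (x : V) :
  {near x, f =1 g} -> differentiable f x -> differentiable g x.
Proof.
move=> fg /diff_locallyP[cf /eqaddoP df].
have fgx : f x = g x by exact: nbhs_singleton fg.
have h : g \o shift x = cst (g x) + 'd f x +o_0 id.
  apply/eqaddoP => e e0; have := df e e0.
  have : \forall h \near (0 : V), f (h + x) = g (h + x).
    by move: fg; rewrite (near_shift 0) /=; apply: filterS => y /=; rewrite subr0.
  by apply: filterS2 => h /=; rewrite !fctE /= -fgx => ->.
by apply/diff_locallyP; rewrite (diff_unique cf h).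
Qed.

Lemma Ck_ext (R : realType) n (W : normedModType R) k (U : set 'rV[R]_n)
    (f g : 'rV[R]_n -> W) :
  open U -> (forall x, U x -> f x = g x) -> Ck k U f -> Ck k U g.
Proof.
move=> oU; elim: k f g => [|k IH] f g fg;
  have fgn x : U x -> \forall y \near x, f y = g y by
    move=> Ux; have := open_nbhs_nbhs (conj oU Ux); apply: (@filterS _ (nbhs x)) => y; exact: fg.
  move=> cf x Ux; have := cf x Ux.
  rewrite /prop_for /continuous_at -(fg x Ux) => cfx; apply: cvg_trans cfx.
  exact: (@near_eq_cvg _ _ (nbhs x) _ f g (fgn x Ux)).
move=> [df Df]; split=> [x Ux|v].
  exact: near_eq_differentiable (fgn x Ux) (df x Ux).
apply: IH (Df v) => x Ux; apply: near_eq_derive; exact: fgn.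
Qed.

Lemma Ck_sub (R : realType) n (W : normedModType R) k (U U' : set 'rV[R]_n)
    (f : 'rV[R]_n -> W) : U' `<=` U -> Ck k U f -> Ck k U' f.
Proof.
move=> UU; elim: k f => [|k IH] f /=; first by move=> cf x /UU/cf.
by move=> [df Df]; split=> [x /UU/df//|v]; apply: IH.
Qed.

Lemma CkW (R : realType) n (W : normedModType R) k (U : set 'rV[R]_n)
    (f : 'rV[R]_n -> W) : Ck k.+1 U f -> Ck k U f.
Proof.
elim: k f => [|k IH] f.
  by move=> [df _] x Ux; exact/differentiable_continuous/df.
by move=> [df Df]; split=> // v; apply: IH.
Qed.

Lemma Ck_cst (R : realType) n (W : normedModType R) k (U : set 'rV[R]_n) (a : W) :
  Ck k U (cst a).
Proof.
elim: k a => [|k IH] a /=; first by move=> x _; exact: cst_continuous.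
split=> // v; have -> : (fun x => 'D_v (cst a : 'rV[R]_n -> W) x) = cst 0.
  by apply/funext => x; exact: derive_cst.
exact: IH.
Qed.

Section CkAlg.
Context (R : realType) (n : nat) (U : set 'rV[R]_n) (oU : open U).
Implicit Types f g : 'rV[R]_n -> R^o.

Lemma Ck_add k f g : Ck k U f -> Ck k U g -> Ck k U (f + g).
Proof.
elim: k f g => [|k IH] f g /=.
  by move=> cf cg x Ux; apply: continuousD; [exact: cf|exact: cg].
move=> [df Df] [dg Dg]; split=> [x Ux|v].
  by apply: differentiableD; [exact: df|exact: dg].
apply: (Ck_ext oU _ (IH _ _ (Df v) (Dg v))) => x Ux.
by rewrite deriveD //; apply: diff_derivable; [exact: df|exact: dg].
Qed.

Lemma Ck_mul k f g : Ck k U f -> Ck k U g -> Ck k U (f * g).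
Proof.
elim: k f g => [|k IH] f g.
  by move=> cf cg x Ux; apply: continuousM; [exact: cf|exact: cg].
move=> cf cg; have [df Df] := cf; have [dg Dg] := cg; split=> [x Ux|v].
  by apply: differentiableM; [exact: df|exact: dg].
apply: (Ck_ext oU _ (Ck_add (IH _ _ (CkW cf) (Dg v)) (IH _ _ (CkW cg) (Df v)))) => x Ux.
by rewrite deriveM //; apply: diff_derivable; [exact: df|exact: dg].
Qed.

Lemma Ck_inv k f : (forall x, U x -> f x != 0) -> Ck k U f ->
  Ck k U (fun x => (f x)^-1 : R^o).
Proof.
move=> f0; elim: k => [|k IH].
  by move=> cf x Ux; apply: continuousV; [exact: f0|exact: cf].
move=> cf; have [df Df] := cf; split=> [x Ux|v].
  by apply: differentiableV; [exact: df|exact: f0].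
have ci := IH (CkW cf).
apply: (Ck_ext oU _ (Ck_mul (Ck_cst k U (-1 : R^o)) (Ck_mul (Ck_mul ci ci) (Df v)))) => x Ux.
rewrite deriveV ?f0 //; last exact/diff_derivable/df.
by rewrite !fctE /= /GRing.scale /=; field; exact: f0.
Qed.

End CkAlg.

Lemma differentiable_rV (R : realType) (V : normedModType R) n
    (G : V -> 'rV[R]_n) (x : V) :
  (forall j, differentiable (fun y => G y 0 j : R^o) x) -> differentiable G x.
Proof.
move=> dG; have -> : G = \sum_(j < n) (fun y => G y 0 j *: delta_mx 0 j).
  by apply/funext => y; rewrite fct_sumE; exact: row_sum_delta.
by apply: differentiable_sum => j; apply: differentiableZl; exact: dG.
Qed.

Lemma derive_sum_delta (R : realType) n (f : 'rV[R]_n -> R^o) x u :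
  differentiable f x ->
  'D_u f x = \sum_(j < n) u 0 j * 'D_(delta_mx 0 j) f x.
Proof.
move=> df; rewrite deriveE // {1}[u]row_sum_delta linear_sum /=.
by apply: eq_bigr => j _; rewrite linearZ /= deriveE.
Qed.

Lemma derive_comp_rV (R : realType) (V : normedModType R) n
    (G : V -> 'rV[R]_n) (f : 'rV[R]_n -> R^o) (x v : V) :
  differentiable G x -> differentiable f (G x) ->
  'D_v (f \o G) x = 'D_(\row_j 'D_v (fun y => G y 0 j : R^o) x) f (G x).
Proof.
move=> dG df; rewrite deriveE; last exact: differentiable_comp.
rewrite (diff_comp dG df) /= -(deriveE _ dG) -(deriveE _ df); congr ('D__ f (G x)).
by rewrite derive_mx; [apply/rowP => j; rewrite !mxE | exact: diff_derivable].
Qed.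

Lemma Ck_proj (R : realType) m k (U : set 'rV[R]_m) (j : 'I_m) :
  Ck k U (fun y : 'rV[R]_m => y 0 j : R^o).
Proof.
case: k => [|k] /=; first by move=> x _; exact: coord_continuous.
split=> [x _|v]; first exact: differentiable_coord.
have -> : (fun x : 'rV[R]_m => 'D_v (fun y : 'rV[R]_m => y 0 j : R^o) x) = cst (v 0 j).
  apply/funext => x.
  have := derive_mx (@derivable_id _ _ x v : derivable (id : 'rV[R]_m -> 'rV[R]_m) _ _).
  by rewrite derive_id => /rowP/(_ j); rewrite !mxE => <-.
exact: Ck_cst.
Qed.

Lemma Ck_sum (R : realType) n (U : set 'rV[R]_n) k (I : Type) (r : seq I)
    (P : pred I) (F : I -> 'rV[R]_n -> R^o) : open U ->
  (forall i, P i -> Ck k U (F i)) ->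
  Ck k U (fun x => \sum_(i <- r | P i) F i x : R^o).
Proof.
move=> oU FS; have -> : (fun x => \sum_(i <- r | P i) F i x : R^o) =
    \sum_(i <- r | P i) F i by apply/funext => x; rewrite fct_sumE.
elim/big_ind : _ => [|f g|//]; [exact: (Ck_cst k U (0 : R^o)) | exact: Ck_add].
Qed.

(** By induction on k: the derivative of f \o G is a sum of products of
derivatives of the components of G with partial derivatives of f composed with
G. *)
Lemma Ck_comp (R : realType) m n (O : set 'rV[R]_m) (U : set 'rV[R]_n) k
    (G : 'rV[R]_m -> 'rV[R]_n) (f : 'rV[R]_n -> R^o) :
  open O -> open U -> (forall y, O y -> U (G y)) ->
  (forall j, Cinfty O (fun y => G y 0 j : R^o)) ->
  Ck k U f -> Ck k O (f \o G : _ -> R^o).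
Proof.
move=> oO oU GU CG.
have dG y : O y -> differentiable G y.
  by move=> Oy; apply: differentiable_rV => j; have [d _] := CG j 1; apply: d.
elim: k f => [|k IH] f Cf.
  move=> y Oy; apply: continuous_comp; last exact: (Cf (G y) (GU y Oy)).
  exact/differentiable_continuous/dG.
have [df Df] := Cf; split=> [y Oy|v].
  by apply: differentiable_comp; [exact: dG | exact/df/GU].
apply: (Ck_ext oO (f := (fun y => \sum_(j < n)
   'D_v (fun y => G y 0 j : R^o) y * ('D_(delta_mx 0 j) f (G y))))).
  move=> y Oy; rewrite derive_comp_rV; [|exact: dG|exact/df/GU].
  rewrite derive_sum_delta; last exact/df/GU.
  by apply: eq_bigr => j _; rewrite mxE.
apply: Ck_sum => // j _; apply: Ck_mul => //.
  by have [_] := CG j k.+1; apply.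
exact: (IH _ (Df (delta_mx 0 j))).
Qed.

Lemma mvt_line (R : realType) n (g : 'rV[R]_n -> R^o) (y u : 'rV[R]_n) (h : R) :
  0 < h -> (forall s, 0 <= s <= h -> differentiable g (s *: u + y)) ->
  exists2 s, 0 <= s <= h & g (h *: u + y) - g y = h * 'D_u g (s *: u + y).
Proof.
move=> h0 dg; pose phi (s : R) : R := g (s *: u + y).
have dl (s : R) : is_diff s (fun s : R => s *: u + y) (fun s : R => s *: u).
    have := is_diffD (is_diff_scalel s u) (is_diff_cst y s).
    by rewrite addr0.
have dphi s : 0 <= s <= h -> differentiable (phi : R -> R^o) s.
  move=> sh; apply: (@differentiable_comp _ _ _ _ (fun s : R => s *: u + y) g).
    by have [] := dl s.
  exact: dg.
have ephi s : 0 <= s <= h -> 'D_1 (phi : R -> R^o) s = 'D_u g (s *: u + y).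
  move=> sh; rewrite deriveE; last exact: dphi.
  rewrite (@diff_comp _ _ _ _ (fun s : R => s *: u + y) g) /=.
  - have [_ ->] := dl s; rewrite scale1r deriveE //; exact: dg.
  - by have [] := dl s.
  - exact: dg.
have := @MVT R phi (fun s => 'D_u g (s *: u + y)) 0 h h0.
case.
- move=> s; rewrite in_itv /= => /andP[s0 sh]; have sh' : 0 <= s <= h by rewrite !ltW.
  by rewrite -ephi //; apply: derivableP; apply: diff_derivable; exact: dphi.
- apply: derivable_within_continuous => s; rewrite in_itv /= => sh.
  by apply: diff_derivable; exact: dphi.
move=> s; rewrite in_itv /= => /andP[s0 sh].
rewrite /phi scale0r add0r subr0 mulrC => e.
by exists s => //; rewrite !ltW.
Qed.

(** Two applications of the mean value theorem: first to y |-> f (y + h v) - f y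
along u, then to the derivative of f in the direction u along v. The left-hand
side is symmetric in u and v, the source of the symmetry of second derivatives.
*)
Lemma second_difference (R : realType) n (U : set 'rV[R]_n) (f : 'rV[R]_n -> R^o)
    (x u v : 'rV[R]_n) (h : R) : 0 < h -> Cinfty U f ->
  (forall s t, 0 <= s <= h -> 0 <= t <= h -> U (s *: u + (t *: v + x))) ->
  exists s t, [/\ 0 <= s <= h, 0 <= t <= h &
    f (h *: u + (h *: v + x)) - f (h *: v + x) - f (h *: u + x) + f x =
    h * (h * 'D_v (fun y => 'D_u f y) (s *: u + (t *: v + x)))].
Proof.
move=> h0 Cf hU; have hh : 0 <= h <= h by rewrite lexx ltW.
have h00 : 0 <= (0 : R) <= h by rewrite lexx ltW.
have df y : U y -> differentiable f y by have [d _] := Cf 1; apply: d.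
have dDf y : U y -> differentiable (fun y => 'D_u f y) y.
  by have [_ /(_ u)[d _]] := Cf 2; apply: d.
pose g (y : 'rV[R]_n) : R^o := f (y + h *: v) - f y.
have dtr s t : 0 <= s <= h -> 0 <= t <= h ->
  is_diff (s *: u + x) (fun y : 'rV[R]_n => f (y + t *: v))
   ('d f (s *: u + (t *: v + x))).
  move=> sh th.
  have e : s *: u + (t *: v + x) = s *: u + x + t *: v.
    by rewrite -addrA [x + _]addrC.
  have ds : is_diff (s *: u + x) (fun y : 'rV[R]_n => y + t *: v) id.
    have := is_diffD (is_diff_id (s *: u + x)) (is_diff_cst (t *: v) (s *: u + x)).
    by rewrite addr0.
  have dd : is_diff (s *: u + x + t *: v) f ('d f (s *: u + x + t *: v)).
    by apply: differentiableP; rewrite -e; apply: df; exact: hU.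
  rewrite e; exact: (@is_diff_comp _ _ _ _ (fun y => y + t *: v) id f _ _ ds dd).
have dg s : 0 <= s <= h -> differentiable g (s *: u + x).
  move=> sh; have [d1 _] := dtr s h sh hh.
  have d0 : differentiable f (s *: u + x).
    by move: (hU s 0 sh h00); rewrite scale0r add0r; apply: df.
  exact: differentiableB.
have [s sh es] := mvt_line h0 dg.
have Dg : 'D_u g (s *: u + x) =
    'D_u f (h *: v + (s *: u + x)) - 'D_u f (s *: u + x).
  have [d1 e1] := dtr s h sh hh.
  have d0 : differentiable f (s *: u + x).
    by move: (hU s 0 sh h00); rewrite scale0r add0r; apply: df.
  rewrite deriveB; [|exact: diff_derivable|exact: diff_derivable].
  have dd := df _ (hU s h sh hh).
  by rewrite (deriveE _ d1) e1 -(deriveE _ dd) addrCA.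
have [t th et] := @mvt_line R n (fun y => 'D_u f y) (s *: u + x) v h h0
  (fun t th => ltac:(by rewrite addrCA; exact/dDf/hU)).
exists s, t; split=> //.
rewrite [s *: u + _]addrCA -et -Dg -es /g addrAC.
by rewrite -!addrA [x + _]addrC opprD opprK; ring.
Qed.

(** For arbitrarily small h, the symmetric second difference equals h^2 times a
value of either mixed derivative at a point close to x; both mixed derivatives
are continuous. *)
Lemma schwarz (R : realType) n (U : set 'rV[R]_n) (f : 'rV[R]_n -> R^o)
    (x u v : 'rV[R]_n) : open U -> U x -> Cinfty U f ->
  'D_v (fun y => 'D_u f y) x = 'D_u (fun y => 'D_v f y) x.
Proof.
move=> oU Ux Cf; apply/eqP; rewrite -subr_eq0 -normr_le0; apply/ler_addgt0Pr => e e0.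
have e20 : 0 < e / 2 by rewrite divr_gt0.
have cc a b : {for x, continuous (fun y => 'D_a (fun z => 'D_b f z) y : R^o)}.
  have [_ /(_ b)[_ /(_ a) c]] := Cf 2; exact: (c x Ux).
have n1 := cc v u; have n2 := cc u v.
move: n1 n2 => /cvgrPdist_lt/(_ _ e20) n1 /cvgrPdist_lt/(_ _ e20) n2.
have n0 : \forall y \near x, U y by exact: open_nbhs_nbhs.
have [d /= d0 db] := (nbhs_ballP _ _).1 (filterI n0 (filterI n1 n2)).
have [h h0 hd] : exists2 h : R, 0 < h & h * (`|u| + `|v|) < d.
  exists (d / (`|u| + `|v| + 1)); first by rewrite divr_gt0 // ltr_wpDl.
  by rewrite mulrAC ltr_pdivrMr ?ltr_wpDl // ltr_pM2l // ltrDl.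
have bl s t : 0 <= s <= h -> 0 <= t <= h -> ball x d (s *: u + (t *: v + x)).
  move=> /andP[s0 sh] /andP[t0 th]; rewrite -ball_normE /= addrA opprD addrCA subrr addr0 normrN.
  apply: le_lt_trans (ler_normD _ _) _; apply: le_lt_trans hd.
  by rewrite mulrDr !normrZ !ger0_norm //; apply: lerD; exact: ler_wpM2r.
have Ub s t : 0 <= s <= h -> 0 <= t <= h -> U (s *: u + (t *: v + x)).
  by move=> sh th; have [] := db _ (bl s t sh th).
have Ub' s t : 0 <= s <= h -> 0 <= t <= h -> U (s *: v + (t *: u + x)).
  by move=> sh th; rewrite addrCA; exact: Ub.
have [s [t [sh th e1]]] := second_difference h0 Cf Ub.
have [s' [t' [sh' th' e2]]] := second_difference h0 Cf Ub'.
have hab : 'D_v (fun y => 'D_u f y) (s *: u + (t *: v + x)) =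
       'D_u (fun y => 'D_v f y) (s' *: v + (t' *: u + x)).
  have hn0 : h != 0 by rewrite gt_eqF.
  have inj2 (a b : R) : h * (h * a) = h * (h * b) -> a = b.
    by move=> /(mulfI hn0)/(mulfI hn0).
  apply: inj2; apply: etrans (esym e1) _; apply: etrans e2.
  by rewrite (addrCA (h *: v)) (addrAC (f _)).
have [_ [ha _]] := db _ (bl s t sh th).
have [_ [_ hb]] := db _ (bl t' s' th' sh'); rewrite (addrCA (t' *: u)) in hb.
have tri (a b c d' : R) : `|a - c| < e / 2 -> `|b - d'| < e / 2 -> c = d' ->
    `|a - b| <= 0 + e.
  move=> ac bd cd; rewrite add0r -(subrKA c); apply: le_trans (ler_normD _ _) _.
  rewrite [leRHS]splitr; apply: lerD; first exact: ltW.
  by rewrite cd distrC ltW.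
exact: (tri _ _ _ _ ha hb hab).
Qed.

(** * Smooth functions on a manifold *)

Lemma open_near (T : topologicalType) (U : set T) :
  (forall p, U p -> \forall q \near p, U q) -> open U.
Proof.
by move=> h; rewrite openE => p Up; exact: h.
Qed.

Lemma continuous_rV (R : realType) (T : topologicalType) n (Y : T -> 'rV[R]_n) p :
  (forall j, {for p, continuous (fun q => Y q 0 j : R^o)}) ->
  {for p, continuous Y}.
Proof.
move=> cY; have -> : Y = \sum_(j < n) (fun y => Y y 0 j *: delta_mx 0 j).
  by apply/funext => y; rewrite fct_sumE; exact: row_sum_delta.
elim/big_ind : _ => [|f g|j _]; first exact: cst_continuous.
  by move=> cf cg; exact: continuousD.
by apply: cvgZr_tmp; exact: cY.
Qed.

Section SmoothFunctions.
Context (R : realType) (n : nat) (M : manifold R n).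
Implicit Types (U B : set M) (f g : M -> R) (c d : chart R M n).

Definition chart_coord c (i : 'I_n) : M -> R := fun p => cfwd c p 0 i.

Lemma cimgE c U : is_chart c ->
  cfwd c @` (cdom c `&` U) = [set y | cimg c y /\ U (cinv c y)].
Proof.
move=> hc; apply/seteqP; split=> [y [p [cp Up] <-]|y [[p cp <-]]] /=.
  by rewrite cfwdK //; split=> //; exists p.
by rewrite cfwdK // => Up; exists p.
Qed.

Lemma open_cfwd_img c U : matlas c -> open U -> open (cfwd c @` (cdom c `&` U)).
Proof.
move=> /m_charts hc oU; rewrite cimgE //; apply: open_near => y [cy Uy].
have oi := cimg_open hc.
have n1 : \forall z \near y, cimg c z by exact: open_nbhs_nbhs.
have n2 : \forall z \near y, U (cinv c z).
  by apply: (cinv_continuous hc cy); exact: open_nbhs_nbhs.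
exact: filterI n1 n2.
Qed.

Lemma smooth_on_sub U B f : open B -> B `<=` U -> smooth_on U f -> smooth_on B f.
Proof.
move=> oB BU [oU sf]; split=> // c hc k; apply: Ck_sub (sf c hc k).
by move=> y [p [cp Bp] <-]; exists p => //; split=> //; exact: BU.
Qed.

Lemma smooth_on_ext U f g : (forall p, U p -> f p = g p) ->
  smooth_on U f -> smooth_on U g.
Proof.
move=> fg [oU sf]; split=> // c hc k.
apply: Ck_ext (sf c hc k); first exact: open_cfwd_img.
by move=> y; rewrite cimgE; [move=> [_ Uy] /=; exact: fg | exact: m_charts].
Qed.

Lemma smooth_on_near U f p : smooth_on U f -> U p -> smooth_near p f.
Proof. by move=> *; exists U. Qed.

Lemma smooth_on_cst U (a : R) : open U -> smooth_on U (fun=> a).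
Proof. by move=> oU; split=> // c hc k; exact: (Ck_cst k _ (a : R^o)). Qed.

Lemma smooth_on_add U f g : smooth_on U f -> smooth_on U g ->
  smooth_on U (fun p => f p + g p).
Proof.
move=> [oU sf] [_ sg]; split=> // c hc k.
by apply: Ck_add (sf c hc k) (sg c hc k); exact: open_cfwd_img.
Qed.

Lemma smooth_on_mul U f g : smooth_on U f -> smooth_on U g ->
  smooth_on U (fun p => f p * g p).
Proof.
move=> [oU sf] [_ sg]; split=> // c hc k.
by apply: Ck_mul (sf c hc k) (sg c hc k); exact: open_cfwd_img.
Qed.

Lemma smooth_on_inv U f : (forall p, U p -> f p != 0) -> smooth_on U f ->
  smooth_on U (fun p => (f p)^-1).
Proof.
move=> f0 [oU sf]; split=> // c hc k.
apply: Ck_inv (sf c hc k); first exact: open_cfwd_img.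
by move=> y [p [cp Up] <-] /=; rewrite cfwdK; [exact: f0|exact: m_charts|].
Qed.

Lemma smooth_on_opp U f : smooth_on U f -> smooth_on U (fun p => - f p).
Proof.
move=> sf; apply: (smooth_on_ext _ (smooth_on_mul (smooth_on_cst (-1) sf.1) sf)).
by move=> p _; rewrite mulN1r.
Qed.

Lemma smooth_on_sum U (I : Type) (r : seq I) (P : pred I) (F : I -> M -> R) :
  open U -> (forall i, P i -> smooth_on U (F i)) ->
  smooth_on U (fun p => \sum_(i <- r | P i) F i p).
Proof.
move=> oU sF; have -> : (fun p => \sum_(i <- r | P i) F i p) =
    \sum_(i <- r | P i) F i by apply/funext => x; rewrite fct_sumE.
by elim/big_ind : _ => [|f g|//]; [exact: smooth_on_cst | exact: smooth_on_add].
Qed.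

Lemma smooth_on_prod U (I : Type) (r : seq I) (P : pred I) (F : I -> M -> R) :
  open U -> (forall i, P i -> smooth_on U (F i)) ->
  smooth_on U (fun p => \prod_(i <- r | P i) F i p).
Proof.
move=> oU sF.
elim: r => [|i r IH].
  apply: smooth_on_ext (smooth_on_cst 1 oU) => p _; by rewrite big_nil.
have [Pi|nPi] := boolP (P i).
  by apply: smooth_on_ext (smooth_on_mul (sF i Pi) IH) => p _; rewrite big_cons Pi.
by apply: smooth_on_ext IH => p _; rewrite big_cons (negPf nPi).
Qed.

Lemma smooth_on_continuous U f p : smooth_on U f -> U p ->
  {for p, continuous (f : M -> R^o)}.
Proof.
move=> [oU sf] Up; have [c hc cp] := m_cover p; have ic := m_charts hc.
have cU : cimg c (cfwd c p) by exists p.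
have n1 : \forall q \near p, cdom c q.
  by apply: open_nbhs_nbhs; split=> //; exact: cdom_open ic.
have c1 : {for p, continuous ((f \o cinv c : _ -> R^o) \o cfwd c)}.
  apply: continuous_comp; first exact: cfwd_continuous ic _ cp.
  by apply: (sf c hc 0); exists p.
rewrite /prop_for /continuous_at; have -> : f p = f (cinv c (cfwd c p)) by rewrite cfwdK.
apply: cvg_trans c1; apply: (@near_eq_cvg _ _ (nbhs p)).
by apply: filterS n1 => q cq /=; rewrite cfwdK.
Qed.

Lemma smooth_on_neq0 U f p : smooth_on U f -> U p -> f p != 0 ->
  exists2 B, open B /\ B p & B `<=` U /\ forall q, B q -> f q != 0.
Proof.
move=> sf Up fp; exists (U `&` [set q | f q != 0]); last first.
  by split=> // q [].
split=> //; apply: open_near => q [Uq fq].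
have n1 : \forall z \near q, U z by apply: open_nbhs_nbhs; split=> //; exact: sf.1.
have n2 : \forall z \near q, f z != 0.
  have cf := smooth_on_continuous sf Uq.
  apply: (cf [set y | y != 0]); apply: open_nbhs_nbhs; split=> //; exact: open_neq.
exact: filterI n1 n2.
Qed.

(** This is where compatibility of the charts of the atlas is used. *)
Lemma chart_coord_smooth c i : matlas c -> smooth_on (cdom c) (chart_coord c i).
Proof.
move=> hc; have ic := m_charts hc; split; first exact: cdom_open ic.
move=> d hd k; have id := m_charts hd.
have oO : open (cfwd d @` (cdom d `&` cdom c)).
  by apply: open_cfwd_img => //; exact: cdom_open ic.
have cd := m_compat hd hc.
suff h (G : 'rV[R]_n -> 'rV[R]_n) : Ck k (cfwd d @` (cdom d `&` cdom c)) G ->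
    Ck k (cfwd d @` (cdom d `&` cdom c)) (fun y => G y 0 i : R^o).
  exact: (h _ (cd k)).
elim: k G => [|k IH] G.
  move=> cG y Oy; apply: (@continuous_comp _ _ _ G (fun v : 'rV[R]_n => v 0 i : R^o)).
    exact: cG.
  exact: coord_continuous.
move=> [dG DG]; split=> [y Oy|v].
  apply: (@differentiable_comp _ _ _ _ G (fun v : 'rV[R]_n => v 0 i : R^o)).
    exact: dG.
  exact: differentiable_coord.
apply: Ck_ext (IH _ (DG v)) => // y Oy.
by rewrite derive_mx; [rewrite mxE | exact/diff_derivable/dG].
Qed.

(** Stated with the components of Y because smoothness on a manifold is defined
for real functions only. *)
Lemma smooth_on_comp m U (Y : M -> 'rV[R]_m) (O : set 'rV[R]_m)
    (G : 'rV[R]_m -> R^o) :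
  open U -> (forall j, smooth_on U (fun p => Y p 0 j)) -> open O -> Cinfty O G ->
  smooth_on (U `&` Y @^-1` O) (G \o Y).
Proof.
move=> oU sY oO CG; have oUY : open (U `&` Y @^-1` O).
  apply: open_near => q [Uq Oq].
  have n1 : \forall z \near q, U z by exact: open_nbhs_nbhs.
  have cY : {for q, continuous Y}.
    by apply: continuous_rV => j; exact: smooth_on_continuous (sY j) Uq.
  have n2 : \forall z \near q, O (Y z) by apply: cY; exact: open_nbhs_nbhs.
  exact: filterI n1 n2.
split=> // c hc k; have ic := m_charts hc.
apply: (@Ck_comp R n m _ O k (Y \o cinv c) G _ oO _ _ (CG k)).
- exact: open_cfwd_img.
- by move=> y [p [cp [Up Op]] <-] /=; rewrite cfwdK.
- move=> j; have [_ sYj] := smooth_on_sub oUY (@subIsetl _ _ _) (sY j).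
  exact: sYj.
Qed.

End SmoothFunctions.

(** * Tangent vectors and vector fields *)

Lemma derive_linear (R : realType) n (f : 'rV[R]_n -> R^o) (x : 'rV[R]_n) k
    (a : 'I_k -> R) (u : 'I_k -> 'rV[R]_n) : differentiable f x ->
  'D_(\sum_(i < k) a i *: u i) f x = \sum_(i < k) a i * 'D_(u i) f x.
Proof.
move=> df; rewrite (deriveE _ df) linear_sum /=.
by apply: eq_bigr => i _; rewrite linearZ /= (deriveE _ df).
Qed.

Section TangentVectors.
Context (R : realType) (n : nat) (M : manifold R n).
Implicit Types (U B : set M) (f g : M -> R) (c d : chart R M n) (p : M)
  (v w : oper M).

Lemma smooth_near_add p f g : smooth_near p f -> smooth_near p g ->
  smooth_near p (fun q => f q + g q).
Proof.
move=> [U sf Up] [B sg Bp]; have oUB : open (U `&` B) := openI sf.1 sg.1.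
exists (U `&` B) => //.
by apply: smooth_on_add; [apply: smooth_on_sub sf|apply: smooth_on_sub sg] => // q [].
Qed.

Lemma smooth_near_mul p f g : smooth_near p f -> smooth_near p g ->
  smooth_near p (fun q => f q * g q).
Proof.
move=> [U sf Up] [B sg Bp]; have oUB : open (U `&` B) := openI sf.1 sg.1.
exists (U `&` B) => //.
by apply: smooth_on_mul; [apply: smooth_on_sub sf|apply: smooth_on_sub sg] => // q [].
Qed.

Lemma smooth_near_cst p (a : R) : smooth_near p (fun=> a).
Proof. by exists setT => //; apply: smooth_on_cst; exact: openT. Qed.

Lemma smooth_near_sum p k (F : 'I_k -> M -> R) : (forall i, smooth_near p (F i)) ->
  smooth_near p (fun q => \sum_(i < k) F i q).
Proof.
move=> sF; have -> : (fun p => \sum_(i < k) F i p) =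
    \sum_(i < k) F i by apply/funext => x; rewrite fct_sumE.
elim/big_ind : _ => [|f g|//]; [exact: smooth_near_cst | exact: smooth_near_add].
Qed.

Lemma smooth_near_ext p U f g : open U -> U p -> (forall q, U q -> f q = g q) ->
  smooth_near p f -> smooth_near p g.
Proof.
move=> oU Up fg [B sf Bp]; have oUB : open (U `&` B) := openI oU sf.1.
exists (U `&` B) => //; apply: (@smooth_on_ext _ _ _ _ f); first by move=> q [/fg].
by apply: smooth_on_sub sf => // q [].
Qed.

Lemma smooth_near_differentiable c p f : matlas c -> cdom c p -> smooth_near p f ->
  differentiable (f \o cinv c : _ -> R^o) (cfwd c p).
Proof.
by move=> hc cp [U [oU sf] Up]; have [df _] := sf c hc 1; apply: df; exists p.
Qed.

(** By definition, the tangent vectors at p are these operators, for all charts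
around p. *)
Definition chart_vector c (u : 'rV[R]_n) p : oper M :=
  germ_oper p (fun f => 'D_u (f \o cinv c : 'rV[R]_n -> R^o) (cfwd c p)).

Lemma chart_vector_tangent c u p : matlas c -> cdom c p -> tangent p (chart_vector c u p).
Proof. by move=> hc cp; exists c, u. Qed.

Lemma tangent_germ p v f : tangent p v -> ~ smooth_near p f -> v f = 0.
Proof. by move=> [c [u [_ _ ->]]] nf; rewrite /germ_oper asboolF. Qed.

Lemma germ_operE p (v : oper M) f : smooth_near p f -> germ_oper p v f = v f.
Proof. by move=> sf; rewrite /germ_oper asboolT. Qed.

Lemma germ_ext p (v w : oper M) : (forall f, smooth_near p f -> v f = w f) ->
  germ_oper p v = germ_oper p w.
Proof.
by move=> vw; apply/funext => f; rewrite /germ_oper; case: asboolP => // /vw.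
Qed.

Lemma tangent_germK p v : tangent p v -> germ_oper p v = v.
Proof.
move=> tv; apply/funext => f; rewrite /germ_oper; case: asboolP => // nf.
by rewrite (tangent_germ tv nf).
Qed.

Lemma tangent_ext p v w : tangent p v -> tangent p w ->
  (forall f, smooth_near p f -> v f = w f) -> v = w.
Proof.
by move=> tv tw vw; rewrite -(tangent_germK tv) -(tangent_germK tw); exact: germ_ext.
Qed.

Lemma tangent_near p v U f g : tangent p v -> open U -> U p ->
  (forall q, U q -> f q = g q) -> v f = v g.
Proof.
move=> tv oU Up fg; have [sf|nf] := pselect (smooth_near p f); last first.
  rewrite (tangent_germ tv nf) (tangent_germ tv) // => sg; apply: nf.
  by apply: smooth_near_ext oU Up _ sg => q /fg.
have sg := smooth_near_ext oU Up fg sf.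
case: tv => [c [u [hc cp ->]]]; rewrite !germ_operE //.
have ic := m_charts hc; apply: near_eq_derive.
have oV := open_cfwd_img hc oU.
have : \forall y \near cfwd c p, (cfwd c @` (cdom c `&` U)) y.
  by apply: open_nbhs_nbhs; split=> //; exists p.
by apply: filterS => y [q [cq Uq] <-] /=; rewrite cfwdK //; exact: fg.
Qed.

Lemma tangent_add p v f g : tangent p v -> smooth_near p f -> smooth_near p g ->
  v (fun q => f q + g q) = v f + v g.
Proof.
move=> [c [u [hc cp ->]]] sf sg; rewrite !germ_operE //; last exact: smooth_near_add.
have df := smooth_near_differentiable hc cp sf.
have dg := smooth_near_differentiable hc cp sg.
exact: (deriveD (diff_derivable df) (diff_derivable dg)).
Qed.

Lemma tangent_mul p v f g : tangent p v -> smooth_near p f -> smooth_near p g ->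
  v (fun q => f q * g q) = f p * v g + g p * v f.
Proof.
move=> [c [u [hc cp ->]]] sf sg; rewrite !germ_operE //; last exact: smooth_near_mul.
have df := smooth_near_differentiable hc cp sf.
have dg := smooth_near_differentiable hc cp sg.
have := deriveM (diff_derivable (v := u) df) (diff_derivable (v := u) dg).
by rewrite /= (cfwdK (m_charts hc)).
Qed.

Lemma tangent_cst p v (a : R) : tangent p v -> v (fun=> a) = 0.
Proof.
move=> [c [u [hc cp ->]]]; rewrite germ_operE; last exact: smooth_near_cst.
exact: derive_cst.
Qed.

Lemma tangent_sum p v k (F : 'I_k -> M -> R) : tangent p v ->
  (forall i, smooth_near p (F i)) ->
  v (fun q => \sum_(i < k) F i q) = \sum_(i < k) v (F i).
Proof.
move=> tv; elim: k F => [|k IH] F sF.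
  under eq_fun do rewrite big_ord0; by rewrite big_ord0; exact: tangent_cst tv.
under eq_fun do rewrite big_ord_recl.
by rewrite (tangent_add tv) ?IH ?big_ord_recl //; apply: smooth_near_sum.
Qed.

(** The basic tool for changes of coordinates: with Y the coordinates of a chart
it expresses tangent vectors in that chart, and with Y the coordinates of a map
it computes pushforwards. *)
Lemma tangent_chain p v m U (Y : M -> 'rV[R]_m) (O : set 'rV[R]_m)
    (G : 'rV[R]_m -> R^o) : tangent p v -> U p -> open U ->
  (forall j, smooth_on U (fun q => Y q 0 j)) -> open O -> Cinfty O G -> O (Y p) ->
  v (G \o Y) = 'D_(\row_j v (fun q => Y q 0 j)) G (Y p).
Proof.
move=> [c [u [hc cp ->]]] Up oU sY oO CG Op; have ic := m_charts hc.
rewrite germ_operE; last first.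
  by exists (U `&` Y @^-1` O) => //; exact: smooth_on_comp.
have dG : differentiable G (Y (cinv c (cfwd c p))).
  by rewrite cfwdK //; have [dG _] := CG 1; apply: dG.
rewrite -[G \o Y \o cinv c]/(G \o (Y \o cinv c)) derive_comp_rV //; last first.
  apply: differentiable_rV => j.
  apply: (@smooth_near_differentiable c p (fun q => Y q 0 j) hc cp).
  by exists U; [exact: sY|].
rewrite /= cfwdK //; congr ('D__ G (Y p)); apply/rowP => j; rewrite !mxE germ_operE //.
by exists U => //; exact: sY.
Qed.

(** A tangent vector is given in one unspecified chart by definition. Near p any
f is the composite of f \o cinv c with the coordinates of c, so the chain rule
represents the vector in the chart c. *)
Lemma tangentE c p v : matlas c -> cdom c p -> tangent p v ->
  v = chart_vector c (\row_i v (chart_coord c i)) p.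
Proof.
move=> hc cp tv; have ic := m_charts hc.
apply: (tangent_ext tv (chart_vector_tangent _ hc cp)) => f sf.
rewrite /chart_vector germ_operE //; have [U [oU cf] Up] := sf.
have oV := open_cfwd_img hc oU.
have oc : open (cdom c) by exact: cdom_open.
rewrite -(@tangent_chain p v n (cdom c) (cfwd c) _ (f \o cinv c) tv cp oc
   (fun j => chart_coord_smooth j hc) oV (cf c hc)); last by exists p.
by apply: (tangent_near tv oc cp) => q cq /=; rewrite cfwdK.
Qed.

Lemma chart_vector_coord c u p i : matlas c -> cdom c p ->
  chart_vector c u p (chart_coord c i) = u 0 i.
Proof.
move=> hc cp; have ic := m_charts hc; rewrite /chart_vector germ_operE; last first.
  by exists (cdom c) => //; exact: chart_coord_smooth.
have pr : differentiable (fun y : 'rV[R]_n => y 0 i : R^o) (cfwd c p).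
  exact: differentiable_coord.
rewrite (near_eq_derive _ (g := fun y : 'rV[R]_n => y 0 i : R^o)).
  have := derive_mx (@derivable_id _ _ (cfwd c p) u : derivable (id : 'rV[R]_n -> 'rV[R]_n) _ _).
  by rewrite derive_id => /rowP/(_ i); rewrite !mxE => <-.
have : \forall y \near cfwd c p, cimg c y.
  by apply: open_nbhs_nbhs; split; [exact: cimg_open | exists p].
by apply: filterS => y [q cq <-]; rewrite /chart_coord /= cfwdK.
Qed.

Lemma tangent_coord_inj c p v w : matlas c -> cdom c p -> tangent p v -> tangent p w ->
  (forall i, v (chart_coord c i) = w (chart_coord c i)) -> v = w.
Proof.
move=> hc cp tv tw vw; rewrite (tangentE hc cp tv) (tangentE hc cp tw).
by congr chart_vector; apply/rowP => i; rewrite !mxE.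
Qed.

(** All the vectors can be represented in one and the same chart, where the
coordinate derivative is linear in its direction. *)
Lemma tangent_lincomb p k (a : 'I_k -> R) (v : 'I_k -> oper M) :
  (forall i, tangent p (v i)) -> tangent p (lincomb a v).
Proof.
move=> tv; have [c hc cp] := m_cover p.
pose u := \sum_(i < k) a i *: (\row_j v i (chart_coord c j)).
suff -> : lincomb a v = chart_vector c u p by exact: chart_vector_tangent.
apply/funext => f; rewrite /lincomb; have [sf|nf] := pselect (smooth_near p f).
  rewrite /chart_vector germ_operE // derive_linear; last exact: smooth_near_differentiable.
  by apply: eq_bigr => i _; rewrite {1}(tangentE hc cp (tv i)) /chart_vector germ_operE.
rewrite (tangent_germ (chart_vector_tangent _ hc cp) nf) big1 // => i _.
by rewrite (tangent_germ (tv i) nf) mulr0.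
Qed.

Lemma tangent_comb p (a : R) v w : tangent p v -> tangent p w ->
  tangent p (fun f => a * v f + w f).
Proof.
move=> tv tw.
have -> : (fun f => a * v f + w f) =
    lincomb (fun i : 'I_2 => if i == 0 then a else 1) (fun i => if i == 0 then v else w).
  by apply/funext => f; rewrite /lincomb !big_ord_recl big_ord0 /= mul1r addr0.
by apply: tangent_lincomb => i; case: ifP.
Qed.

Lemma tangent0 p : tangent p (ozero M).
Proof.
have -> : ozero M = lincomb (fun _ : 'I_0 => 0) (fun _ => ozero M).
  by apply/funext => f; rewrite /lincomb big_ord0.
by apply: tangent_lincomb => -[].
Qed.

Lemma tangentZ p (a : R) v : tangent p v -> tangent p (fun f => a * v f).
Proof.
move=> tv; have := tangent_comb a tv (tangent0 p).
by congr tangent; apply/funext => f; rewrite /ozero addr0.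
Qed.

Lemma tangent_chart_sum c p v : matlas c -> cdom c p -> tangent p v ->
  v = lincomb (fun i => v (chart_coord c i)) (fun i => chart_vector c (delta_mx 0 i) p).
Proof.
move=> hc cp tv; apply: (tangent_coord_inj hc cp tv).
  by apply: tangent_lincomb => i; exact: chart_vector_tangent.
move=> j; rewrite /lincomb (bigD1 j) //= chart_vector_coord // mxE !eqxx mulr1.
by rewrite big1 ?addr0 // => i ij; rewrite chart_vector_coord // mxE eqxx eq_sym (negPf ij) mulr0.
Qed.

Lemma vfield_sub U B X : open B -> B `<=` U -> vfield_on U X -> vfield_on B X.
Proof.
move=> oB BU [oU tX sX]; split=> // [p /BU/tX//|D f DB sf].
by apply: sX => // q /DB/BU.
Qed.

Lemma vfield_smooth U X f B : vfield_on U X -> smooth_on B f ->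
  smooth_on (U `&` B) (fun p => X p f).
Proof.
move=> [oU tX sX] sf; apply: sX; first exact: subIsetl.
exact: smooth_on_sub (openI oU sf.1) (@subIsetr _ _ _) sf.
Qed.

Lemma vfield_smooth_near U X f p : vfield_on U X -> U p -> smooth_near p f ->
  smooth_near p (fun q => X q f).
Proof.
by move=> vX Up [B sf Bp]; exists (U `&` B) => //; exact: vfield_smooth.
Qed.

Lemma chart_vector_vfield c u : matlas c -> vfield_on (cdom c) (chart_vector c u).
Proof.
move=> hc; have ic := m_charts hc; have oc : open (cdom c) by exact: cdom_open.
split=> // [p cp|B f Bc sf]; first exact: chart_vector_tangent.
have [oB Cf] := sf; pose O := cfwd c @` (cdom c `&` B).
pose G := fun y => 'D_u (f \o cinv c : _ -> R^o) y.
have CG : Cinfty O G by move=> k; have [_] := Cf c hc k.+1; apply.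
have oO : open O by exact: open_cfwd_img.
have := smooth_on_comp oc (fun j => chart_coord_smooth j hc) oO CG.
move=> /(smooth_on_sub oB) sG; apply: smooth_on_ext (sG _) => p Bp.
  by rewrite /chart_vector germ_operE //; exists B.
by split; [exact: Bc | exists p => //; split=> //; exact: Bc].
Qed.

Lemma vfield_lincomb U k (a : 'I_k -> M -> R) (X : 'I_k -> M -> oper M) :
  open U -> (forall i, smooth_on U (a i)) -> (forall i, vfield_on U (X i)) ->
  vfield_on U (fun q => lincomb (fun i => a i q) (fun i => X i q)).
Proof.
move=> oU sa vX; split=> // [p Up|B f BU sf].
  by apply: tangent_lincomb => i; have [_ t _] := vX i; exact: t.
have [oB _] := sf; apply: smooth_on_sum => // i _; apply: smooth_on_mul.
  exact: smooth_on_sub (sa i).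
by have [_ _ s] := vX i; exact: s.
Qed.

Lemma vfieldZ U a X : smooth_on U a -> vfield_on U X ->
  vfield_on U (fun q f => a q * X q f).
Proof.
move=> sa vX; have [oU _ _] := vX.
have := @vfield_lincomb U 1 (fun=> a) (fun=> X) oU (fun=> sa) (fun=> vX).
congr vfield_on; apply/funext => q; apply/funext => f.
by rewrite /lincomb big_ord_recl big_ord0 addr0.
Qed.

Lemma vfield_comb U a X Y : smooth_on U a -> vfield_on U X -> vfield_on U Y ->
  vfield_on U (fun q f => a q * X q f + Y q f).
Proof.
move=> sa vX vY; have [oU _ _] := vX.
have h1 (i : 'I_2) : smooth_on U (if i == 0 then a else (fun=> 1)).
  by case: ifP => _ //; exact: smooth_on_cst.
have h2 (i : 'I_2) : vfield_on U (if i == 0 then X else Y) by case: ifP.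
have := vfield_lincomb oU h1 h2.
congr vfield_on; apply/funext => q; apply/funext => f.
by rewrite /lincomb !big_ord_recl big_ord0 /= mul1r addr0.
Qed.

Lemma lie_bracketE X Y p f : smooth_near p f ->
  lie_bracket X Y p f = X p (fun q => Y q f) - Y p (fun q => X q f).
Proof. by move=> sf; rewrite /lie_bracket germ_operE. Qed.

End TangentVectors.

(** * Brackets, pushforwards, frames and exterior derivatives *)

Section LieBracket.
Context (R : realType) (n : nat) (M : manifold R n).
Implicit Types (U B : set M) (f g : M -> R) (c d : chart R M n) (p : M)
  (v w : oper M).

(** The commutation of coordinate vector fields is the symmetry of second
derivatives in the chart. *)
Lemma chart_vector_comm c (u w : 'rV[R]_n) p f : matlas c -> cdom c p -> smooth_near p f ->
  chart_vector c u p (fun q => chart_vector c w q f) =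
  chart_vector c w p (fun q => chart_vector c u q f).
Proof.
move=> hc cp sf; have ic := m_charts hc; have [U [oU Cf] Up] := sf.
have oV := open_cfwd_img hc oU; set O := cfwd c @` _ in oV.
have Op : O (cfwd c p) by exists p.
have key (a b : 'rV[R]_n) : chart_vector c a p (fun q => chart_vector c b q f) =
    'D_a (fun y => 'D_b (f \o cinv c : _ -> R^o) y : R^o) (cfwd c p).
  rewrite {1}/chart_vector germ_operE; last first.
    exact: vfield_smooth_near (chart_vector_vfield b hc) cp sf.
  apply: near_eq_derive; have : \forall y \near cfwd c p, O y by exact: open_nbhs_nbhs.
  apply: filterS => y [q [cq Uq] <-].
  by rewrite /= cfwdK // /chart_vector germ_operE //; exists U.
by rewrite !key; apply: schwarz oV Op (Cf c hc).
Qed.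

Lemma vfield_deriv_chart U c X p f : vfield_on U X -> U p -> matlas c -> cdom c p ->
  X p f = \sum_i X p (chart_coord c i) * chart_vector c (delta_mx 0 i) p f.
Proof.
move=> [_ tX _] Up hc cp; rewrite {1}(tangent_chart_sum hc cp (tX _ Up)).
by rewrite /lincomb.
Qed.

(** Expansion of X (Y f) in a chart: a first-order part and a second-order part;
the latter is symmetric in X and Y by commutation of the coordinate fields. *)
Lemma vfield_deriv2_chart U c X Y p f : vfield_on U X -> vfield_on U Y -> U p ->
  matlas c -> cdom c p -> smooth_near p f ->
  X p (fun q => Y q f) =
    \sum_j X p (fun q => Y q (chart_coord c j)) * chart_vector c (delta_mx 0 j) p f +
    \sum_j \sum_i Y p (chart_coord c j) * X p (chart_coord c i) *
      chart_vector c (delta_mx 0 i) p (fun q => chart_vector c (delta_mx 0 j) q f).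
Proof.
move=> vX vY Up hc cp sf; have ic := m_charts hc.
have [oU tX _] := vX; have tXp := tX _ Up.
have oUc : open (U `&` cdom c) by apply: openI => //; exact: cdom_open.
have cUp : (U `&` cdom c) p by [].
have sco j : smooth_near p (chart_coord c j) by exists (cdom c) => //; exact: chart_coord_smooth.
have sY j := vfield_smooth_near vY Up (sco j).
have sd j := vfield_smooth_near (chart_vector_vfield (delta_mx 0 j) hc) cp sf.
rewrite (tangent_near tXp oUc cUp (g := fun q => \sum_j
    Y q (chart_coord c j) * chart_vector c (delta_mx 0 j) q f)); last first.
  by move=> q [Uq cq]; exact: vfield_deriv_chart vY Uq hc cq.
rewrite (tangent_sum tXp); last by move=> j; exact: smooth_near_mul.
rewrite -big_split /=; apply: eq_bigr => j _.
rewrite (tangent_mul tXp (sY j) (sd j)) addrC; congr (_ + _); last exact: mulrC.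
rewrite (vfield_deriv_chart (fun q => chart_vector c (delta_mx 0 j) q f) vX Up hc cp).
rewrite mulr_sumr.
by apply: eq_bigr => i _; rewrite mulrA.
Qed.

(** The second-order parts of X (Y f) and Y (X f) cancel, and what remains is a
combination of first-order coordinate derivatives. *)
Lemma lie_bracket_tangent U X Y p : vfield_on U X -> vfield_on U Y -> U p ->
  tangent p (lie_bracket X Y p).
Proof.
move=> vX vY Up; have [c hc cp] := m_cover p.
pose u := \row_j (X p (fun q => Y q (chart_coord c j)) - Y p (fun q => X q (chart_coord c j))).
suff -> : lie_bracket X Y p = chart_vector c u p by exact: chart_vector_tangent.
rewrite /lie_bracket /chart_vector; apply: germ_ext => f sf.
rewrite (vfield_deriv2_chart vX vY Up hc cp sf) (vfield_deriv2_chart vY vX Up hc cp sf).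
rewrite opprD addrACA -sumrB.
have -> : \sum_j \sum_i Y p (chart_coord c j) * X p (chart_coord c i) *
      chart_vector c (delta_mx 0 i) p (fun q => chart_vector c (delta_mx 0 j) q f) =
    \sum_j \sum_i X p (chart_coord c j) * Y p (chart_coord c i) *
      chart_vector c (delta_mx 0 i) p (fun q => chart_vector c (delta_mx 0 j) q f).
  rewrite exchange_big /=; apply: eq_bigr => i _; apply: eq_bigr => j _.
  by rewrite chart_vector_comm // [_ * X p _]mulrC.
rewrite subrr addr0 derive_sum_delta; last exact: smooth_near_differentiable.
by apply: eq_bigr => j _; rewrite mxE mulrBl /chart_vector germ_operE.
Qed.

Lemma lie_bracket_anti X Y p :
  lie_bracket X Y p = (fun f => -1 * lie_bracket Y X p f).
Proof.
apply/funext => f; rewrite /lie_bracket /germ_oper; case: ifP => _.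
  by rewrite mulN1r opprB.
by rewrite mulr0.
Qed.

End LieBracket.

Section Pushforward.
Context (R : realType) (m n : nat) (M : manifold R m) (N : manifold R n).
Implicit Types (F : M -> N) (p : M) (v : oper M).

Lemma pushforwardE F p v f : smooth_near (F p) f -> pushforward F p v f = v (f \o F).
Proof. by move=> sf; rewrite /pushforward germ_operE. Qed.

Lemma smooth_map_near U F p f : smooth_map_on U F -> U p -> smooth_near (F p) f ->
  smooth_near p (f \o F).
Proof. by move=> sF Up [B sf Bp]; exists (U `&` F @^-1` B) => //; exact: sF. Qed.

Lemma smooth_map_open U F B : smooth_map_on U F -> open B -> open (U `&` F @^-1` B).
Proof. by move=> sF oB; have [] := sF B (fun=> 0) (smooth_on_cst 0 oB). Qed.

Lemma pushforward_tangent U F p v : smooth_map_on U F -> U p -> tangent p v ->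
  tangent (F p) (pushforward F p v).
Proof.
move=> sF Up tv; have [d hd dp] := m_cover (F p); have id := m_charts hd.
pose u := \row_j v (chart_coord d j \o F).
suff -> : pushforward F p v = chart_vector d u (F p) by exact: chart_vector_tangent.
apply: germ_ext => f [B [oB Cf] Bp].
have od : open (cdom d) by exact: cdom_open.
pose U' := U `&` F @^-1` cdom d.
have oU' : open U' by exact: smooth_map_open.
have oO := open_cfwd_img hd oB.
have U'p : U' p by [].
have OY : (cfwd d @` (cdom d `&` B)) (cfwd d (F p)) by exists (F p).
have sY j : smooth_on U' (fun q => (cfwd d \o F) q 0 j).
  exact: sF _ _ (chart_coord_smooth j hd).
have <- := @tangent_chain _ _ M p v n U' (cfwd d \o F) _ (f \o cinv d) tv U'p oU' sY oO
  (Cf d hd) OY.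
by apply: (tangent_near tv oU' U'p) => q [_ dq] /=; rewrite cfwdK.
Qed.

Lemma pushforward_lincomb F p k (a : 'I_k -> R) (v : 'I_k -> oper M) :
  pushforward F p (lincomb a v) = lincomb a (fun i => pushforward F p (v i)).
Proof.
apply/funext => f; rewrite /pushforward /germ_oper /lincomb; case: ifP => // _.
by rewrite big1 // => i _; rewrite mulr0.
Qed.

Lemma pushforward_comb F p (a : R) (v w : oper M) :
  pushforward F p (fun f => a * v f + w f) =
  (fun f => a * pushforward F p v f + pushforward F p w f).
Proof.
apply/funext => f; rewrite /pushforward /germ_oper; case: ifP => // _.
by rewrite mulr0 addr0.
Qed.

(** Fields related by F act compatibly on functions pulled back by F: X (f \o F)
= (X' f) \o F; applying this twice relates the brackets. *)
Lemma pushforward_lie_bracket F U B X Y X' Y' p : smooth_map_on U F ->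
  vfield_on U X -> vfield_on U Y -> vfield_on B X' -> vfield_on B Y' ->
  (forall q, U q -> B (F q)) ->
  (forall q, U q -> pushforward F q (X q) = X' (F q)) ->
  (forall q, U q -> pushforward F q (Y q) = Y' (F q)) ->
  U p -> pushforward F p (lie_bracket X Y p) = lie_bracket X' Y' (F p).
Proof.
move=> sF vX vY vX' vY' UB FX FY Up; rewrite {2}/lie_bracket.
apply: germ_ext => f sf; have [D sfD Dp] := sf.
have [_ tX _] := vX; have [_ tY _] := vY.
have sfF : smooth_near p (f \o F) by exact: smooth_map_near sF Up sf.
rewrite (lie_bracketE _ _ sfF).
pose U' := U `&` F @^-1` D; have oU' : open U' by apply: smooth_map_open sF sfD.1.
have U'p : U' p by [].
have key (Z1 Z2 : M -> oper M) (Z1' Z2' : N -> oper N) :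
    vfield_on U Z1 -> vfield_on B Z2' ->
    (forall q, U q -> pushforward F q (Z1 q) = Z1' (F q)) ->
    (forall q, U q -> pushforward F q (Z2 q) = Z2' (F q)) ->
    Z1 p (fun q => Z2 q (f \o F)) = Z1' (F p) (fun q => Z2' q f).
  move=> [_ tZ1 _] vZ2' FZ1 FZ2; rewrite -FZ1 // pushforwardE; last first.
    exact: vfield_smooth_near vZ2' (UB _ Up) sf.
  apply: (tangent_near (tZ1 _ Up) oU' U'p) => q [Uq Dq] /=.
  by rewrite -FZ2 // pushforwardE //; exists D.
by rewrite (key X Y X' Y') // (key Y X Y' X').
Qed.

End Pushforward.

Lemma smooth_map_comp (R : realType) l m n (L : manifold R l) (M : manifold R m)
    (N : manifold R n) (F : L -> M) (G : M -> N) U U' :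
  smooth_map_on U F -> smooth_map_on U' G ->
  smooth_map_on (U `&` F @^-1` U') (G \o F).
Proof.
move=> sF sG B f sf; have := sF _ _ (sG _ _ sf).
by congr smooth_on; apply/seteqP; split => p /=; tauto.
Qed.

Lemma pushforward_comp (R : realType) l m n (L : manifold R l) (M : manifold R m)
    (N : manifold R n) (F : L -> M) (G : M -> N) U p (v : oper L) :
  smooth_map_on U G -> U (F p) ->
  pushforward G (F p) (pushforward F p v) = pushforward (G \o F) p v.
Proof.
move=> sG UFp; apply: germ_ext => f sf; rewrite pushforwardE //.
exact: smooth_map_near sG UFp sf.
Qed.

Section Frames.
Context (R : realType) (n : nat) (M : manifold R n).
Implicit Types (U B : set M) (f g : M -> R) (c d : chart R M n) (p : M)
  (v w : oper M).

Definition independent k (e : 'I_k -> oper M) :=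
  forall a : 'I_k -> R, lincomb a e = ozero M -> forall i, a i = 0.

Definition frame_mx c (e : 'I_n -> M -> oper M) p : 'M[R]_n :=
  \matrix_(i, j) e i p (chart_coord c j).

Lemma frame_mx_unit c e p : matlas c -> cdom c p -> (forall i, tangent p (e i p)) ->
  independent (e ^~ p) -> frame_mx c e p \in unitmx.
Proof.
move=> hc cp te ie; rewrite -row_free_unit; apply: inj_row_free => a /rowP a0.
have := ie (fun i => a 0 i); rewrite (_ : lincomb _ _ = ozero M); last first.
  apply: (tangent_coord_inj hc cp); first exact: tangent_lincomb.
    exact: tangent0.
  move=> j; have := a0 j; rewrite !mxE /ozero => <-; apply: eq_bigr => i _.
  by rewrite mxE.
by move=> /(_ erefl) h; apply/rowP => i; rewrite mxE h.
Qed.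

Lemma frame_mx_coef c e p v : matlas c -> cdom c p -> (forall i, tangent p (e i p)) ->
  frame_mx c e p \in unitmx -> tangent p v ->
  v = lincomb (fun i => ((\row_j v (chart_coord c j)) *m invmx (frame_mx c e p)) 0 i)
        (e ^~ p).
Proof.
move=> hc cp te ue tv; apply: (tangent_coord_inj hc cp tv).
  exact: tangent_lincomb.
move=> j; set a := _ *m _; have : (a *m frame_mx c e p) 0 j = v (chart_coord c j).
  by rewrite /a mulmxKV // mxE.
by rewrite mxE => <-; apply: eq_bigr => i _; rewrite [frame_mx c e p i j]mxE.
Qed.

(** A dimension count: the matrix of n independent vectors in the coordinates of
a chart is invertible. *)
Lemma frame_span p (e : 'I_n -> oper M) v : (forall i, tangent p (e i)) ->
  independent e -> tangent p v -> exists a : 'I_n -> R, v = lincomb a e.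
Proof.
move=> te ie tv; have [c hc cp] := m_cover p.
have u := @frame_mx_unit c (fun i _ => e i) p hc cp te ie.
eexists; exact: (@frame_mx_coef c (fun i _ => e i) p v hc cp te u tv).
Qed.

Lemma smooth_det U k (N : M -> 'M[R]_k) : open U ->
  (forall i j, smooth_on U (fun q => N q i j)) -> smooth_on U (fun q => \det (N q)).
Proof.
move=> oU sN; apply: smooth_on_sum => // s _; apply: smooth_on_mul.
  exact: smooth_on_cst.
exact: smooth_on_prod.
Qed.

(** Cramer's formula: an entry of the inverse is a quotient of determinants,
hence a rational function of the entries. *)
Lemma smooth_invmx U k (N : M -> 'M[R]_k) i j : open U ->
  (forall i j, smooth_on U (fun q => N q i j)) ->
  (forall q, U q -> N q \in unitmx) -> smooth_on U (fun q => invmx (N q) i j).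
Proof.
move=> oU sN uN; apply: (smooth_on_ext (f := fun q =>
    (\det (N q))^-1 * ((-1) ^+ (j + i) * \det (row' j (col' i (N q)))))).
  by move=> q Uq; rewrite /invmx uN // !mxE /cofactor.
apply: smooth_on_mul.
  apply: smooth_on_inv; last exact: smooth_det.
  by move=> q /uN; rewrite unitmxE unitfE.
apply: smooth_on_mul; first exact: smooth_on_cst.
apply: smooth_det => // i' j'; apply: smooth_on_ext (sN (lift j i') (lift i j')).
by move=> q _; rewrite !mxE.
Qed.

Lemma smooth_unitmx U k (N : M -> 'M[R]_k) p : open U ->
  (forall i j, smooth_on U (fun q => N q i j)) -> U p -> N p \in unitmx ->
  exists2 B, open B /\ B p & B `<=` U /\ forall q, B q -> N q \in unitmx.
Proof.
move=> oU sN Up; rewrite unitmxE unitfE => d0.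
have [B [oB Bp] [BU h]] := smooth_on_neq0 (smooth_det oU sN) Up d0.
by exists B => //; split=> // q /h; rewrite unitmxE unitfE.
Qed.

(** The coefficients of X in a frame are obtained by multiplying the coordinates
of X with the inverse of the matrix of the frame, which is smooth and invertible
near p. *)
Lemma frame_coef U (e : 'I_n -> M -> oper M) p : (forall i, vfield_on U (e i)) -> U p ->
  open U -> independent (e ^~ p) ->
  exists2 B, open B /\ B p & B `<=` U /\
   (forall D X, D `<=` B -> vfield_on D X -> exists a : 'I_n -> M -> R,
     (forall i, smooth_on D (a i)) /\
     forall q, D q -> X q = lincomb (a ^~ q) (e ^~ q)).
Proof.
move=> ve Up oU ie; have [c hc cp] := m_cover p.
have oc : open (cdom c) by exact/cdom_open/m_charts.
have oUc := openI oU oc.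
have te q i : U q -> tangent q (e i q) by move=> Uq; have [_ t _] := ve i; exact: t.
have sN i j : smooth_on (U `&` cdom c) (fun q => frame_mx c e q i j).
  apply: smooth_on_ext (vfield_smooth (ve i) (chart_coord_smooth j hc)).
  by move=> q _; rewrite mxE.
have u0 : frame_mx c e p \in unitmx by apply: frame_mx_unit => // i; exact: te.
have [B [oB Bp] [BU uB]] := smooth_unitmx oUc sN (conj Up cp) u0.
exists B => //; split=> [q /BU[]//|D X DB vX]; have [oD tX _] := vX.
exists (fun i q => ((\row_j X q (chart_coord c j)) *m invmx (frame_mx c e q)) 0 i).
have DU : D `<=` U `&` cdom c by move=> q /DB/BU.
split=> [i|q Dq]; last first.
  have [Uq cq] := DU _ Dq.
  by apply: frame_mx_coef => //; [move=> i; exact: te | exact/uB/DB | exact: tX].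
apply: (smooth_on_ext (f := fun q => \sum_j X q (chart_coord c j) *
    invmx (frame_mx c e q) j i)).
  by move=> q _; rewrite mxE; apply: eq_bigr => j _; rewrite mxE.
apply: smooth_on_sum => // j _; apply: smooth_on_mul.
  apply: smooth_on_sub (vfield_smooth vX (chart_coord_smooth j hc)) => //.
  by move=> q Dq; split=> //; have [] := DU _ Dq.
apply: smooth_invmx => //; last by move=> q /DB/uB.
by move=> k l; apply: smooth_on_sub (sN k l).
Qed.

End Frames.

Section OneForms.
Context (R : realType) (n : nat) (M : manifold R n).
Implicit Types (U B : set M) (f g : M -> R) (p : M) (v w : oper M).

Lemma tlinearZ p l (a : R) v : @tlinear R n M p l -> tangent p v ->
  l (fun f => a * v f) = a * l v.
Proof.
move=> hl tv.
have l0 : l (ozero M) = 0.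
  have := hl 1 _ _ (tangent0 p) (tangent0 p).
  rewrite (_ : (fun f => 1 * ozero M f + ozero M f) = ozero M); last first.
    by apply/funext => f; rewrite /ozero mulr0 addr0.
  by lra.
have := hl a _ _ tv (tangent0 p); rewrite l0 addr0 => <-.
by congr l; apply/funext => f; rewrite /ozero addr0.
Qed.

Lemma tlinear0 p l : @tlinear R n M p l -> l (ozero M) = 0.
Proof.
move=> hl; have := tlinearZ 0 hl (tangent0 p); rewrite mul0r => <-.
by congr l; apply/funext => f; rewrite mul0r.
Qed.

Lemma tlinear_lincomb p l k (a : 'I_k -> R) (v : 'I_k -> oper M) :
  @tlinear R n M p l -> (forall i, tangent p (v i)) ->
  l (lincomb a v) = \sum_i a i * l (v i).
Proof.
move=> hl; elim: k a v => [|k IH] a v tv.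
  rewrite big_ord0 -(tlinear0 hl); congr l; apply/funext => f.
  by rewrite /lincomb big_ord0.
rewrite big_ord_recl -IH // -hl //; last exact: tangent_lincomb.
by congr l; apply/funext => f; rewrite /lincomb big_ord_recl.
Qed.

Lemma ext_deriv1_anti U a X Y p : is_form1_on U a -> vfield_on U X -> vfield_on U Y ->
  U p -> ext_deriv1 a X Y p = - ext_deriv1 a Y X p.
Proof.
move=> [_ la _] vX vY Up; rewrite /ext_deriv1 lie_bracket_anti.
rewrite (tlinearZ _ (la _ Up)); last exact: lie_bracket_tangent vY vX Up.
ring.
Qed.

(** The derivatives of the coefficients b in Y (a (X)) cancel against those that
the Leibniz rule produces in a ([X, Y]). *)
Lemma ext_deriv1_lincomb U a k (b : 'I_k -> M -> R) (e : 'I_k -> M -> oper M) X Y p :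
  is_form1_on U a -> vfield_on U X -> vfield_on U Y ->
  (forall i, vfield_on U (e i)) -> (forall i, smooth_on U (b i)) ->
  (forall q, U q -> X q = lincomb (b ^~ q) (e ^~ q)) -> U p ->
  ext_deriv1 a X Y p = \sum_i b i p * ext_deriv1 a (e i) Y p.
Proof.
move=> [oU la sa] vX vY ve sb XE Up.
have te q i : U q -> tangent q (e i q) by move=> Uq; have [_ t _] := ve i; exact: t.
have tY : tangent p (Y p) by have [_ t _] := vY; exact: t.
have sbp i : smooth_near p (b i) by exact: smooth_on_near (sb i) Up.
have se i : smooth_near p (fun q => a q (e i q)).
  by apply: smooth_on_near Up; apply: sa.
have brE : lie_bracket X Y p = (fun f => -1 * lincomb (fun i => Y p (b i)) (e ^~ p) f +
    lincomb (b ^~ p) (fun i => lie_bracket (e i) Y p) f).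
  apply: (tangent_ext (p := p)).
  - exact: lie_bracket_tangent vX vY Up.
  - apply: tangent_comb; apply: tangent_lincomb => i; first exact: te.
    exact: lie_bracket_tangent (ve i) vY Up.
  move=> f sf; rewrite (lie_bracketE _ _ sf) XE //.
  have sef i := vfield_smooth_near (ve i) Up sf.
  rewrite (tangent_near tY oU Up (g := fun q => \sum_i b i q * e i q f)); last first.
    by move=> q Uq; rewrite XE.
  rewrite (tangent_sum tY); last by move=> i; exact: smooth_near_mul.
  rewrite /lincomb -sumrB mulN1r -sumrN -big_split /=; apply: eq_bigr => i _.
  by rewrite (lie_bracketE _ _ sf) (tangent_mul tY) //; ring.
rewrite /ext_deriv1 brE (la _ Up); first last.
- by apply: tangent_lincomb => i; exact: lie_bracket_tangent (ve i) vY Up.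
- by apply: tangent_lincomb => i; exact: te.
rewrite !(tlinear_lincomb _ (la _ Up)); first last.
- by move=> i; exact: te.
- by move=> i; exact: lie_bracket_tangent (ve i) vY Up.
rewrite (tangent_near tY oU Up (g := fun q => \sum_i b i q * a q (e i q))); last first.
  by move=> q Uq; rewrite XE // (tlinear_lincomb _ (la _ Uq)) // => i; exact: te.
rewrite (tangent_sum tY); last by move=> i; exact: smooth_near_mul.
rewrite XE // /lincomb opprD mulN1r opprK addrA -!sumrB -big_split -sumrB /=.
by apply: eq_bigr => i _; rewrite (tangent_mul tY) //; ring.
Qed.

End OneForms.

(** * Circle bundles with a connection *)

Section CircleAction.
Context (R : realType) (n : nat) (M : manifold R n) (rho : R -> M -> M).
Context (act : circle_action rho).
Implicit Types (p : M) (c : chart R M n).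

Let orbit_map c (y : 'rV[R]_(1 + n)) := rho (lsubmx y ord0 ord0) (cinv c (rsubmx y)).

(** In a chart, rho t is the joint action composed with the affine map y |-> (t,
y). *)
Lemma action_smooth t : smooth_map_on setT (rho t).
Proof.
have [_ _ _ sm] := act.
move=> B f sf; pose K (y : 'rV[R]_n) : 'rV[R]_(1 + n) := row_mx t%:M y.
have FK c y : orbit_map c (K y) = rho t (cinv c y).
  by rewrite /orbit_map /K row_mxKl row_mxKr mxE eqxx.
have CK U j : Cinfty U (fun y => K y 0 j : R^o).
  move=> k; rewrite /K; case: (splitP j) => i ij.
    have -> : (fun y : 'rV[R]_n => row_mx t%:M y 0 j : R^o) = cst (t%:M 0 i).
      by apply/funext => y; rewrite (_ : j = lshift n i) ?row_mxEl //; apply/val_inj.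
    exact: Ck_cst.
  have -> : (fun y : 'rV[R]_n => row_mx t%:M y 0 j : R^o) = (fun y => y 0 i).
    by apply/funext => y; rewrite (_ : j = rshift 1 i) ?row_mxEr //; apply/val_inj.
  exact: Ck_proj.
have cK : continuous K.
  by move=> y; apply: continuous_rV => j; exact: (CK setT j 0 y I).
have oB : open (setT `&` rho t @^-1` B).
  rewrite setTI; apply: open_near => q Bq.
  have [c hc cq] := m_cover q; have ic := m_charts hc.
  have [oU _] := sm B f c sf hc.
  have n1 : \forall y \near K (cfwd c q),
      cimg c (rsubmx y) /\ B (orbit_map c y).
    apply: open_nbhs_nbhs; split=> //=; rewrite FK cfwdK // /K row_mxKr.
    by split=> //; exists q.
  have n2 : \forall z \near q, cdom c z.
    by apply: open_nbhs_nbhs; split=> //; exact: cdom_open ic.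
  have n3 := cfwd_continuous ic cq (cK _ _ n1).
  move: n2 n3; apply: filterS2 => z cz [_] /=.
  by rewrite FK cfwdK.
split=> // c hc k; have ic := m_charts hc; have [oU CU] := sm B f c sf hc.
have oV := open_cfwd_img hc oB.
apply: (Ck_ext oV (f := (f \o orbit_map c) \o K)); first by move=> y _ /=; rewrite FK.
apply: (Ck_comp oV oU _ (CK _) (CU k)) => y [q [cq [_ Bq]] <-] /=.
rewrite -/(orbit_map c _) FK cfwdK // /K row_mxKr.
by split=> //; exists q.
Qed.

(** The definition only gives a derivative along the orbit of p. Joint
smoothness of the action makes the orbit a differentiable curve in a chart, and
the chain rule identifies the derivative along it with the one in the direction
of its velocity. *)
Lemma fundamental_field_tangent p : tangent p (fundamental_field rho p).
Proof.
have [rho0 _ _ sm] := act.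
have [c hc cp] := m_cover p; have ic := m_charts hc.
have oc : open (cdom c) by exact: cdom_open.
pose K (t : R) : 'rV[R]_(1 + n) :=
  t *: row_mx (1%:M : 'M[R]_1) 0 + row_mx (0 : 'M[R]_1) (cfwd c p).
have FK t : orbit_map c (K t) = rho t p.
  rewrite /orbit_map /K !linearD !linearZ /= !row_mxKl !row_mxKr !mxE eqxx.
  by rewrite addr0 mulr1 scaler0 add0r cfwdK.
have dK t : differentiable (K : R^o -> 'rV[R]_(1 + n)) t.
  by have [] := is_diffD (is_diff_scalel t (row_mx (1%:M : 'M[R]_1) (0 : 'rV[R]_n)))
    (is_diff_cst (row_mx (0 : 'M[R]_1) (cfwd c p)) t).
have KU B : B p -> cimg c (rsubmx (K 0)) /\ B (orbit_map c (K 0)).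
  move=> Bp; rewrite FK rho0; split=> //.
  by rewrite /K scale0r add0r row_mxKr; exists p.
pose gam (t : R) := cfwd c (rho t p).
have dgam : differentiable (gam : R^o -> 'rV[R]_n) 0.
  apply: differentiable_rV => j.
  have [oU CU] := sm _ _ c (chart_coord_smooth j hc) hc.
  have -> : (fun t => gam t 0 j : R^o) =
      (chart_coord c j \o orbit_map c : 'rV[R]_(1 + n) -> R^o) \o K.
    by apply/funext => t /=; rewrite FK.
  apply: differentiable_comp; first exact: dK.
  by have [d _] := CU 1; apply: d; exact: KU.
have ngam : \forall t \near (0 : R), cdom c (rho t p).
  have [oU _] := sm _ _ c (smooth_on_cst 0 oc) hc.
  have n1 : \forall y \near K 0, cimg c (rsubmx y) /\ cdom c (orbit_map c y).
    by apply: open_nbhs_nbhs; split; [exact: oU|exact: KU].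
  have := differentiable_continuous (dK 0) n1.
  by apply: (@filterS _ (nbhs (0 : R))) => t [_]; rewrite FK.
pose u := \row_j 'D_1 (fun t => gam t 0 j : R^o) (0 : R^o).
suff -> : fundamental_field rho p = chart_vector c u p by exact: chart_vector_tangent.
apply: germ_ext => f sf; rewrite derive1E.
have df := smooth_near_differentiable hc cp sf.
have g0 : gam 0 = cfwd c p by rewrite /gam rho0.
rewrite -g0 in df *; rewrite -derive_comp_rV //.
apply: near_eq_derive; move: ngam; apply: filterS => t ct.
by rewrite /gam /= cfwdK.
Qed.

End CircleAction.

Section ConnectionBundle.
Context (R : realType) (n : nat) (M : manifold R n.+1) (V : manifold R n).
Context (prj : M -> V) (rho : R -> M -> M) (A : form1 M).
Context (bundle : principal_circle_bundle prj rho) (conn : connection_form rho A).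
Implicit Types (p q : M).

Let prj_smooth : smooth_map_on setT prj. Proof. by have [] := bundle. Qed.
Let act : circle_action rho. Proof. by have [] := bundle. Qed.
Let linA p : tlinear p (A p). Proof. by have [[_ l _] _ _] := conn; exact: l. Qed.

(** A point p of the fibre over x is rho t (sg x) for a local section sg; then
rho t \o sg is a section of prj through p, and its pushforward is a right
inverse of that of prj. *)
Lemma prj_submersion p (u : oper V) : tangent (prj p) u ->
  exists2 v, tangent p v & pushforward prj p v = u.
Proof.
move=> tu; have [_ _ prjr triv] := bundle.
have [U [sg [co [si [oU Up [[sgs sgE] _ fib _]]]]]] := triv (prj p).
have [t pE] := fib p Up.
pose G := rho t \o sg.
have sG : smooth_map_on U G.
  have := smooth_map_comp sgs (action_smooth act t).
  by rewrite preimage_setT setIT.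
have Gp : G (prj p) = p by rewrite /G /= -pE.
exists (pushforward G (prj p) u).
  by rewrite -[X in tangent X]Gp; exact: pushforward_tangent sG Up tu.
rewrite -[X in pushforward prj X]Gp (pushforward_comp _ prj_smooth) //.
have pG x : U x -> (prj \o G) x = x by move=> Ux; rewrite /= prjr sgE.
rewrite -[RHS](tangent_germK tu) /pushforward pG //; apply: germ_ext => f sf.
by apply: (tangent_near tu oU Up) => x Ux; rewrite -[in RHS](pG x Ux).
Qed.

Lemma prj_fundamental_field p : pushforward prj p (fundamental_field rho p) = ozero V.
Proof.
have [_ _ prjr _] := bundle.
apply/funext => f; rewrite /pushforward {1}/germ_oper; case: asboolP => // sf.
rewrite /fundamental_field germ_operE; last exact: smooth_map_near prj_smooth I sf.
have -> : (fun t => (f \o prj) (rho t p) : R^o) = cst (f (prj p)).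
  by apply/funext => t; rewrite /= prjr.
exact: derive1_cst.
Qed.

(** The pushforward by prj has rank n on a space of dimension n + 1, so its
kernel is a line. It contains the fundamental field, which is nonzero since A
takes the value 1 on it. *)
Lemma vertical_kernel p v : tangent p v -> pushforward prj p v = ozero V ->
  exists a : R, v = (fun f => a * fundamental_field rho p f).
Proof.
move=> tv pv; have [c hc cp] := m_cover p; have [d hd dp] := m_cover (prj p).
have tf := fundamental_field_tangent act p.
pose P : 'M[R]_(n.+1, n) :=
  \matrix_(i, j) pushforward prj p (chart_vector c (delta_mx 0 i) p) (chart_coord d j).
pose co (w : oper M) : 'rV[R]_n.+1 := \row_i w (chart_coord c i).
have coP w : tangent p w -> co w *m P = \row_j pushforward prj p w (chart_coord d j).
  move=> tw; rewrite {2}(tangent_chart_sum hc cp tw) pushforward_lincomb.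
  by apply/rowP => j; rewrite !mxE; apply: eq_bigr => i _; rewrite !mxE.
have rP : \rank P = n.
  apply/eqP; rewrite -/(row_full P) -sub1mx; apply/row_subP => j.
  have [w tw pw] := prj_submersion (chart_vector_tangent (delta_mx 0 j) hd dp).
  apply/submxP; exists (co w); rewrite coP // pw; apply/rowP => k.
  by rewrite !mxE chart_vector_coord // mxE eqxx eq_sym.
have kf : (co (fundamental_field rho p) <= kermx P)%MS.
  apply/sub_kermxP; rewrite coP // prj_fundamental_field.
  by apply/rowP => j; rewrite !mxE.
have kv : (co v <= kermx P)%MS.
  apply/sub_kermxP; rewrite coP // pv.
  by apply/rowP => j; rewrite !mxE.
have f0 : co (fundamental_field rho p) != 0.
  apply/eqP => /rowP c0; have [_ /(_ p) A1 _] := conn.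
  suff e : fundamental_field rho p = ozero M.
    by have := tlinear0 (@linA p); rewrite -e A1 => /eqP; rewrite oner_eq0.
  apply: (tangent_coord_inj hc cp tf); first exact: tangent0.
  by move=> i; have := c0 i; rewrite !mxE.
have : (kermx P <= co (fundamental_field rho p))%MS.
  rewrite -(geq_leqif (mxrank_leqif_sup kf)) mxrank_ker rP subSnn.
  by rewrite lt0n mxrank_eq0.
move=> /(submx_trans kv)/sub_rVP[a /rowP ea]; exists a.
apply: (tangent_coord_inj hc cp tv); first exact: tangentZ.
by move=> i; have := ea i; rewrite !mxE.
Qed.

(** The difference of v and w is a multiple of the fundamental field on which A
vanishes. *)
Lemma horizontal_inj p v w : horizontal A p v -> horizontal A p w ->
  pushforward prj p v = pushforward prj p w -> v = w.
Proof.
move=> [tv Av] [tw Aw] vw.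
have pz : pushforward prj p (fun f => -1 * v f + w f) = ozero V.
  rewrite pushforward_comb vw; apply/funext => f; rewrite /ozero; ring.
have [a ea] := vertical_kernel (tangent_comb (-1) tv tw) pz.
have [_ /(_ p) A1 _] := conn.
have := linA (-1) tv tw; rewrite ea (tlinearZ _ (@linA p)); last first.
  exact: fundamental_field_tangent.
rewrite A1 Av Aw mulr0 addr0 mulr1 => a0; apply/funext => f.
have := congr1 (@^~ f) ea; rewrite a0 mul0r mulN1r addrC => /eqP.
by rewrite subr_eq0 => /eqP.
Qed.

Lemma horizontal_lincomb p k (a : 'I_k -> R) (v : 'I_k -> oper M) :
  (forall i, horizontal A p (v i)) -> horizontal A p (lincomb a v).
Proof.
move=> hv; have tv i : tangent p (v i) by have [] := hv i.
split; first exact: tangent_lincomb.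
by rewrite (tlinear_lincomb _ (@linA p)) // big1 // => i _; have [_ ->] := hv i; rewrite mulr0.
Qed.

(** In charts, the lift of X solves the linear system A (X') = 0, dprj X' = X.
Its square matrix is invertible by injectivity of prj on horizontal vectors,
hence the solution depends smoothly on the point. One U serves for all fields X,
so that several fields can be lifted simultaneously. *)
Lemma horizontal_lift_vfield p (B : set V) : open B -> B (prj p) ->
  exists U : set M, [/\ open U, U p, (forall q, U q -> B (prj q)) &
    forall X, vfield_on B X -> exists X' : M -> oper M, vfield_on U X' /\
      forall q, U q -> horizontal A q (X' q) /\ pushforward prj q (X' q) = X (prj q)].
Proof.
move=> oB Bp; have [c hc cp] := m_cover p; have [d hd dp] := m_cover (prj p).
have oc : open (cdom c) by exact/cdom_open/m_charts.
have od : open (cdom d) by exact/cdom_open/m_charts.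
pose U := cdom c `&` prj @^-1` (B `&` cdom d).
have oU : open U.
  by apply: openI => //; have := smooth_map_open prj_smooth (openI oB od); rewrite setTI.
exists U; split=> //; first by move=> q [_ []].
pose e i := chart_vector c (delta_mx 0 i : 'rV[R]_n.+1).
(* the matrix of v |-> (A v, dprj v) in the coordinates of the two charts *)
pose N q : 'M[R]_(n.+1, 1 + n) := row_mx (\col_i A q (e i q))
   (\matrix_(i, j) e i q (chart_coord d j \o prj)).
have ve i : vfield_on U (e i) by apply: vfield_sub (chart_vector_vfield _ hc) => // q [].
have te q i : U q -> tangent q (e i q) by move=> Uq; have [_ t _] := ve i; exact: t.
have pe q v j : U q -> pushforward prj q v (chart_coord d j) = v (chart_coord d j \o prj).
  move=> [_ [_ dq]]; rewrite pushforwardE //; exists (cdom d) => //.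
  exact: chart_coord_smooth.
have wN (w : 'rV[R]_n.+1) q : U q -> w *m N q =
    row_mx (A q (lincomb (w 0) (e ^~ q)))%:M
      (\row_j pushforward prj q (lincomb (w 0) (e ^~ q)) (chart_coord d j)).
  move=> Uq; rewrite mul_mx_row; congr row_mx.
    apply/rowP => j; rewrite !mxE ord1 eqxx mulr1n (tlinear_lincomb _ (@linA q)).
      by apply: eq_bigr => i _; rewrite mxE.
    by move=> i; exact: te.
  by apply/rowP => j; rewrite !mxE pe //; apply: eq_bigr => i _; rewrite mxE.
have uN q : U q -> (N q : 'M[R]_n.+1) \in unitmx.
  move=> Uq; have [cq [_ dq]] := Uq.
  rewrite -row_free_unit; apply: inj_row_free => w w0.
  have := wN w q Uq; have -> : w *m N q = row_mx 0 0 by rewrite row_mx0; exact: w0.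
  move=> /esym/eq_row_mx[/rowP Aw /rowP pw].
  have tl : tangent q (lincomb (w 0) (e ^~ q)).
    by apply: tangent_lincomb => i; exact: te.
  have l0 : lincomb (w 0) (e ^~ q) = ozero M.
    apply: (@horizontal_inj q).
    - by split=> //; have := Aw 0; rewrite !mxE eqxx.
    - by split; [exact: tangent0 | exact: tlinear0].
    - have o0 : pushforward prj q (ozero M) = ozero V.
        by apply/funext => f; rewrite /pushforward /germ_oper; case: ifP.
      apply: (tangent_coord_inj hd dq).
      + exact: pushforward_tangent prj_smooth I tl.
      + by rewrite o0; exact: tangent0.
      + by move=> j; have := pw j; rewrite o0 !mxE.
  apply/rowP => j; have := congr1 (@^~ (chart_coord c j)) l0.
  rewrite /lincomb (bigD1 j) //= big1 ?addr0 => [|i ij]; last first.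
    by rewrite /e chart_vector_coord // mxE eqxx eq_sym (negPf ij) mulr0.
  by rewrite /e chart_vector_coord // !mxE !eqxx mulr1.
have sA i : smooth_on U (fun q => A q (e i q)).
  by have [[_ _ s] _ _] := conn; apply: s.
have sP i j : smooth_on U (fun q => e i q (chart_coord d j \o prj)).
  have sx := prj_smooth (chart_coord_smooth j hd); rewrite setTI in sx.
  have [_ _ s] := ve i; apply: s => //; apply: smooth_on_sub sx => // q [_ []] //.
have sN i j : smooth_on U (fun q => N q i j).
  case: (splitP j) => k jk.
    apply: smooth_on_ext (sA i) => q _.
    by rewrite (_ : j = lshift n k) ?row_mxEl ?mxE //; apply/val_inj.
  apply: smooth_on_ext (sP i k) => q _.
  by rewrite (_ : j = rshift 1 k) ?row_mxEr ?mxE //; apply/val_inj.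
move=> X vX.
pose b q : 'rV[R]_(1 + n) := row_mx 0 (\row_j X (prj q) (chart_coord d j)).
pose w q : 'rV[R]_n.+1 := b q *m invmx (N q : 'M[R]_n.+1).
have sb j : smooth_on U (fun q => b q 0 j).
  case: (splitP j) => k jk.
    apply: smooth_on_ext (smooth_on_cst 0 oU) => q _.
    by rewrite (_ : j = lshift n k) ?row_mxEl ?mxE //; apply/val_inj.
  have := prj_smooth (vfield_smooth vX (chart_coord_smooth k hd)); rewrite setTI.
  move=> /(smooth_on_sub oU) s; apply: smooth_on_ext (s _) => [q _|q [_ []]//].
  by rewrite /= (_ : j = rshift 1 k) ?row_mxEr ?mxE //; apply/val_inj.
have sw i : smooth_on U (fun q => w q 0 i).
  apply: (smooth_on_ext (f := fun q => \sum_j b q 0 j * invmx (N q : 'M[R]_n.+1) j i)).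
    by move=> q _; rewrite mxE.
  apply: smooth_on_sum => // j _; apply: smooth_on_mul => //.
  exact: smooth_invmx.
exists (fun q => lincomb (w q 0) (e ^~ q)); split.
  exact: vfield_lincomb (fun i q => w q 0 i) e oU sw ve.
move=> q Uq; have [cq [Bq dq]] := Uq.
have : w q *m N q = b q by rewrite /w mulmxKV //; exact: uN.
rewrite wN // => /eq_row_mx[/rowP Aw /rowP pw].
have tl : tangent q (lincomb (w q 0) (e ^~ q)).
  by apply: tangent_lincomb => i; exact: te.
split; first by split=> //; have := Aw 0; rewrite !mxE eqxx.
apply: (tangent_coord_inj hd dq).
- exact: pushforward_tangent prj_smooth I tl.
- by have [_ t _] := vX; exact: t.
- by move=> j; have := pw j; rewrite !mxE.
Qed.

Lemma horizontal_lift_span q (F : distr V) k (e : 'I_k -> oper V) (e' : 'I_k -> oper M) :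
  F (prj q) = [set v | exists a : 'I_k -> R, v = lincomb a e] ->
  (forall i, horizontal A q (e' i)) -> (forall i, pushforward prj q (e' i) = e i) ->
  horizontal_lift prj A F q = [set v | exists a : 'I_k -> R, v = lincomb a e'].
Proof.
move=> FE he pe.
have pl a : pushforward prj q (lincomb a e') = lincomb a e.
  by rewrite pushforward_lincomb; congr lincomb; apply/funext.
apply/seteqP; split=> v /=.
  move=> [hv]; rewrite /= FE => -[a va]; exists a.
  by apply: (@horizontal_inj q) => //; [exact: horizontal_lincomb | rewrite pl].
move=> [a ->]; split; first exact: horizontal_lincomb.
by rewrite /= FE pl; exists a.
Qed.

Lemma horizontal_lift_distribution k (F : distr V) :
  is_distribution k F -> is_distribution k (horizontal_lift prj A F).
Proof.
move=> dF p; have [B [X [Bp vX FX]]] := dF (prj p).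
(* for k = 0 there is no frame field, hence no information that B is open *)
have [oB|nB] := pselect (open B); last first.
  case: k dF X vX FX => [|k] dF X vX FX; last by have [oB] := vX ord0.
  exists setT, (fun _ _ => ozero M); split=> //; first by case.
  move=> q _; split; first by move=> a _ [].
  apply: (@horizontal_lift_span q F 0 (fun=> ozero V)) => //; try by case.
  have [B' [X' [B'q _ /(_ _ B'q) [_ ->]]]] := dF (prj q).
  by apply/seteqP; split=> v [a ->]; exists a; apply/funext => f;
    rewrite /lincomb !big_ord0.
have [U [oU Up UB lift]] := horizontal_lift_vfield oB Bp.
have [X' hX'] := choice (fun i => lift (X i) (vX i)).
exists U, X'; split=> // [i|q Uq]; first by have [] := hX' i.
have [iX FE] := FX _ (UB _ Uq).
have hq i : horizontal A q (X' i q) by have [_ /(_ q Uq)[]] := hX' i.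
have pq i : pushforward prj q (X' i q) = X i (prj q) by have [_ /(_ q Uq)[]] := hX' i.
split; last exact: horizontal_lift_span FE hq pq.
move=> a a0; apply: iX.
have := congr1 (pushforward prj q) a0; rewrite pushforward_lincomb.
have -> : (fun i => pushforward prj q (X' i q)) = X ^~ (prj q) by apply/funext.
move=> ->; apply/funext => f; rewrite /pushforward /germ_oper.
by case: ifP.
Qed.

(** Both functions A (X) and A (Y) vanish, so dA (X, Y) reduces to - A ([X, Y]).
*)
Lemma connection_bracket (F : form2 V) U X Y p : curvature_form prj A F ->
  section_on U (horizontal A) X -> section_on U (horizontal A) Y -> U p ->
  A p (lie_bracket X Y p) =
  - F (prj p) (pushforward prj p (X p)) (pushforward prj p (Y p)).
Proof.
move=> cF [vX hX] [vY hY] Up; have [oU tX _] := vX; have [_ tY _] := vY.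
rewrite -(cF U X Y) // /ext_deriv1.
rewrite (tangent_near (tX _ Up) oU Up (g := fun=> 0)); last by move=> q /hY[].
rewrite (tangent_near (tY _ Up) oU Up (g := fun=> 0)); last by move=> q /hX[].
by rewrite (tangent_cst _ (tX _ Up)) (tangent_cst _ (tY _ Up)) subr0 sub0r opprK.
Qed.

End ConnectionBundle.

(** * Volume forms, distributions and contact frames *)

Section Triples.
Context (T : Type) (x y z : T).

Definition triple (i : 'I_3) : T :=
  if i == 0 :> nat then x else if i == 1 :> nat then y else z.

End Triples.

Notation o0 := (ord0 : 'I_3).
Notation o1 := (lift ord0 ord0 : 'I_3).
Notation o2 := (lift ord0 (lift ord0 ord0) : 'I_3).

Lemma sum3E (R : nmodType) (F : 'I_3 -> R) : \sum_i F i = F o0 + (F o1 + F o2).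
Proof. by rewrite !big_ord_recl big_ord0 addr0. Qed.

Lemma lincomb_tripleE (R : realType) n (M : manifold R n) (a : 'I_3 -> R)
    (u v w : oper M) :
  lincomb a (triple u v w) = (fun f => a o0 * u f + (a o1 * v f + a o2 * w f)).
Proof. by apply/funext => f; rewrite /lincomb sum3E. Qed.

Lemma triple_ind (T : Type) (P : T -> Prop) x y z : P x -> P y -> P z ->
  forall i, P (triple x y z i).
Proof. by move=> Px Py Pz i; rewrite /triple; do 2![case: ifP => _ //]. Qed.

Section VolumeForm.
Context (R : realType) (V : manifold R 3) (b : form3 V) (vol : volume_form b).
Implicit Types (p : V) (u v w : oper V).

Lemma vol_linear p v w : tangent p v -> tangent p w ->
  [/\ tlinear p (fun u => b p u v w), tlinear p (fun u => b p v u w) &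
      tlinear p (fun u => b p v w u)].
Proof. by have [[l _ _] _] := vol; exact: l. Qed.

Lemma vol_alternating p v w : tangent p v -> tangent p w ->
  [/\ b p v v w = 0, b p v w w = 0 & b p v w v = 0].
Proof. by have [[_ l _] _] := vol; exact: l. Qed.

Lemma vol_swap p u v w : tangent p u -> tangent p v -> tangent p w ->
  b p v u w = - b p u v w /\ b p u w v = - b p u v w.
Proof.
move=> tu tv tw; split.
  have t := tangent_comb 1 tu tv.
  have [+ _ _] := vol_alternating t tw.
  have [l1 _ _] := vol_linear t tw; rewrite l1 //.
  have [_ l2 _] := vol_linear tu tw; have [_ l3 _] := vol_linear tv tw.
  rewrite l2 // l3 //; have [-> _ _] := vol_alternating tu tw.
  have [-> _ _] := vol_alternating tv tw; rewrite !mul1r add0r addr0 => /eqP.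
  by rewrite addrC addr_eq0 => /eqP.
have t := tangent_comb 1 tv tw.
have [_ + _] := vol_alternating tu t.
have [_ l1 _] := vol_linear tu t; rewrite l1 //.
have [_ _ l2] := vol_linear tu tv; have [_ _ l3] := vol_linear tu tw.
rewrite l2 // l3 //; have [_ -> _] := vol_alternating tu tv.
have [_ -> _] := vol_alternating tu tw; rewrite !mul1r add0r addr0 => /eqP.
by rewrite addrC addr_eq0 => /eqP.
Qed.

(** Pairing a vanishing combination with two of the three vectors under b
isolates each coefficient. *)
Lemma vol_independent p u v w : tangent p u -> tangent p v -> tangent p w ->
  b p u v w != 0 -> independent (triple u v w).
Proof.
move=> tu tv tw b0 a; rewrite lincomb_tripleE => a0.
have t12 (x y : R) (s t : oper V) : tangent p s -> tangent p t ->
   tangent p (fun f => x * s f + y * t f).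
  by move=> ts tt; apply: tangent_comb => //; exact: tangentZ.
have key (l : oper V -> R) : tlinear p l ->
    a o0 * l u + (a o1 * l v + a o2 * l w) = 0.
  move=> hl; rewrite -(tlinearZ _ hl tw) -hl //; last exact: tangentZ.
  rewrite -hl //; last exact: t12.
  by rewrite a0; exact: tlinear0 hl.
have [e0 _ _] := vol_linear tv tw.
have [_ e1 _] := vol_linear tu tw.
have [_ _ e2] := vol_linear tu tv.
have [z0 _ _] := vol_alternating tv tw; have [_ _ z1] := vol_alternating tw tv.
have [z2 z3 _] := vol_alternating tu tw; have [_ z4 z5] := vol_alternating tu tv.
have := key _ e0; rewrite z0 z1 !mulr0 !addr0 => /eqP.
have := key _ e1; rewrite z2 z3 !mulr0 add0r addr0 => /eqP.
have := key _ e2; rewrite z4 z5 !mulr0 !add0r => /eqP.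
rewrite !mulf_eq0 (negPf b0) !orbF => /eqP h2 /eqP h1 /eqP h0.
by case=> [[|[|[|//]]] i3];
  [rewrite -[RHS]h0|rewrite -[RHS]h1|rewrite -[RHS]h2]; congr a; exact/val_inj.
Qed.

(** Three independent vectors form a basis, so if b vanished on them it would
vanish on all triples by multilinearity and alternation, whereas a volume form
is nonzero on some triple. *)
Lemma independent_vol p u v w : tangent p u -> tangent p v -> tangent p w ->
  independent (triple u v w) -> b p u v w != 0.
Proof.
move=> tu tv tw ie; apply/eqP => b0.
have [_ /(_ p) [x [y [z [tx ty tz]]]]] := vol.
have te : forall i, tangent p (triple u v w i) by exact: triple_ind.
have [ax xE] := frame_span te ie tx.
have [ay yE] := frame_span te ie ty.
have [az zE] := frame_span te ie tz.
have [l1 _ _] := vol_linear ty tz.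
rewrite {1}xE (tlinear_lincomb _ l1 te) big1 ?eqxx // => i _.
have [_ l2 _] := vol_linear (te i) tz.
rewrite {1}yE (tlinear_lincomb _ l2 te) big1 ?mulr0 // => j _.
have [_ _ l3] := vol_linear (te i) (te j).
rewrite {1}zE (tlinear_lincomb _ l3 te) big1 ?mulr0 // => k _.
suff -> : b p (triple u v w i) (triple u v w j) (triple u v w k) = 0 by rewrite mulr0.
have [s1 s2] := vol_swap tu tv tw; have [s3 s4] := vol_swap tv tw tu.
have [s5 s6] := vol_swap tw tu tv.
have alt (s t : oper V) (ts : tangent p s) (tt : tangent p t) := vol_alternating ts tt.
have eqij : i = j -> b p (triple u v w i) (triple u v w j) (triple u v w k) = 0.
  by move=> ->; have [] := alt _ _ (te j) (te k).
have eqjk : j = k -> b p (triple u v w i) (triple u v w j) (triple u v w k) = 0.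
  by move=> ->; have [] := alt _ _ (te i) (te k).
have eqik : i = k -> b p (triple u v w i) (triple u v w j) (triple u v w k) = 0.
  by move=> ->; have [] := alt _ _ (te k) (te j).
have zer (r s : R) : s = - r -> r = 0 -> s = 0 by move=> -> ->; rewrite oppr0.
have buwv := zer _ _ s2 b0; have bvuw := zer _ _ s1 b0.
have [_ s7] := vol_swap tv tu tw; have bvwu := zer _ _ s7 bvuw.
have bwvu := zer _ _ s3 bvwu.
have [s8 _] := vol_swap tu tw tv; have bwuv := zer _ _ s8 buwv.
case: (eqVneq i j) => [/eqij//|]; case: (eqVneq j k) => [/eqjk//|].
case: (eqVneq i k) => [/eqik//|]; clear eqij eqjk eqik l2 l3.
by move: i j k => [[|[|[|//]]] ?] [[|[|[|//]]] ?] [[|[|[|//]]] ?].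
Qed.

End VolumeForm.

Section Extension.
Context (R : realType) (n : nat) (M : manifold R n).

Lemma tangent_extends (p : M) v : tangent p v ->
  exists U X, [/\ vfield_on U X, U p & X p = v].
Proof.
move=> [c [u [hc cp ->]]]; exists (cdom c), (chart_vector c u); split=> //.
exact: chart_vector_vfield.
Qed.

(** The span of k < n vectors is proper, so it misses one of the coordinate
vectors of a chart. *)
Lemma outside_span (p : M) k (v : 'I_k -> oper M) : (k < n)%N ->
  (forall i, tangent p (v i)) ->
  exists2 w, tangent p w & forall a, w <> lincomb a v.
Proof.
move=> kn tv; have [c hc cp] := m_cover p.
pose N : 'M[R]_(k, n) := \matrix_(i, j) v i (chart_coord c j).
have /row_subPn[j nj] : ~~ (1%:M <= N)%MS.
  by rewrite sub1mx /row_full ltn_eqF // (leq_ltn_trans (rank_leq_row _)).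
exists (chart_vector c (delta_mx 0 j) p); first exact: chart_vector_tangent.
move=> a wE; move/negP: nj; apply; apply/submxP; exists (\row_i a i).
apply/rowP => l; rewrite row1; have := chart_vector_coord (delta_mx 0 j) l hc cp.
by rewrite wE => <-; rewrite mxE; apply: eq_bigr => i _; rewrite !mxE.
Qed.

Lemma is_distribution_tangent : is_distribution n (@tangent R n M).
Proof.
move=> p; have [c hc cp] := m_cover p.
exists (cdom c), (fun i => chart_vector c (delta_mx 0 i)); split=> // [i|q cq].
  exact: chart_vector_vfield.
split=> [a a0 i|].
  have := congr1 (@^~ (chart_coord c i)) a0.
  rewrite /lincomb (bigD1 i) //= big1 ?addr0 => [|j ji]; last first.
    by rewrite chart_vector_coord // mxE eqxx eq_sym (negPf ji) mulr0.
  by rewrite chart_vector_coord // !mxE !eqxx mulr1.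
apply/seteqP; split=> v /=.
  by move=> tv; eexists; exact: tangent_chart_sum hc cq tv.
by move=> [a ->]; apply: tangent_lincomb => i; exact: chart_vector_tangent.
Qed.

Lemma is_distribution_line_field (W : M -> oper M) : vfield_on setT W ->
  (forall x, W x <> ozero M) -> is_distribution 1 (line_field W).
Proof.
move=> vW W0 p; exists setT, (fun=> W); split=> // q _; split.
  move=> a a0 i; rewrite (ord1 i); apply: contrapT => ai; apply: (W0 q).
  apply/funext => f; have := congr1 (@^~ f) a0.
  rewrite /lincomb big_ord_recl big_ord0 addr0 /ozero => /eqP.
  by rewrite mulf_eq0 => /orP[/eqP//|/eqP].
apply/seteqP; split=> v /= [a ->].
  by exists (fun=> a); apply/funext => f; rewrite /lincomb big_ord_recl big_ord0 addr0.
by exists (a ord0); apply/funext => f; rewrite /lincomb big_ord_recl big_ord0 addr0.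
Qed.

Lemma lin_span_lincomb (S : set (oper M)) k (a : 'I_k -> R) (v : 'I_k -> oper M) :
  (forall i, lin_span S (v i)) -> lin_span S (lincomb a v).
Proof.
elim: k a v => [|k IH] a v sv.
  exists 0%N, a, v; split=> //; by case.
have [k0 [b0 [w0 [Sw0 v0E]]]] := sv ord0.
have [k1 [b1 [w1 [Sw1 v1E]]]] := IH (fun i => a (lift ord0 i)) _ (fun i => sv (lift ord0 i)).
exists (k0 + k1)%N.
exists (fun i : 'I_(k0 + k1) =>
  match fintype.split i with inl j => a ord0 * b0 j | inr j => b1 j end).
exists (fun i : 'I_(k0 + k1) =>
  match fintype.split i with inl j => w0 j | inr j => w1 j end).
split=> [i|]; first by case: fintype.split.
apply/funext => f; rewrite /lincomb big_ord_recl big_split_ord /=.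
rewrite v0E /lincomb mulr_sumr; congr (_ + _).
  apply: eq_bigr => i _; rewrite mulrA.
  by case: splitP => j /= e; [rewrite (_ : i = j) //; exact/val_inj |
    have := ltn_ord i; rewrite e ltnNge leq_addr].
have := congr1 (@^~ f) v1E; rewrite /lincomb => ->; apply: eq_bigr => i _.
case: splitP => j /= e; last by rewrite (_ : i = j) //; apply/val_inj/(addnI e).
by have := ltn_ord j; rewrite -e ltnNge leq_addr.
Qed.

Lemma lin_span_sub (S : set (oper M)) v : S v -> lin_span S v.
Proof.
move=> Sv; exists 1%N, (fun=> 1), (fun=> v); split=> //.
by apply/funext => f; rewrite /lincomb big_ord_recl big_ord0 addr0 mul1r.
Qed.

(** For a local section Y of D and a function f, [Y, f Y] = (Y f) Y. With f a
coordinate function such that (Y f)(p) is nonzero, this recovers the vector Y p.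
*)
Lemma subset_bracket_distr k (D : distr M) p : is_distribution k D ->
  D p `<=` bracket_distr D D p.
Proof.
move=> dD v Dv; have [U [X [Up vX DX]]] := dD p.
have [v0|v0] := pselect (v = ozero M).
  exists 0%N, (fun=> 0), (fun=> v); split; first by case.
  by rewrite v0; apply/funext => f; rewrite /lincomb big_ord0.
have [_ DE] := DX p Up; move: Dv; rewrite DE => -[a vE].
case: k => [|k] in X vX DX DE a vE dD *.
  case: v0; rewrite vE; apply/funext => f; by rewrite /lincomb big_ord0.
have [oU _ _] := vX ord0.
pose Y q := lincomb a (X ^~ q).
have vY : vfield_on U Y.
  by apply: (vfield_lincomb (a := fun i _ => a i) oU) => // i; exact: smooth_on_cst.
have sY : section_on U D Y.
  by split=> // q Uq; have [_ ->] := DX q Uq; exists a.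
have [c hc cp] := m_cover p; have oc : open (cdom c) by exact/cdom_open/m_charts.
have tv : tangent p v by rewrite vE; have [_ t _] := vY; exact: t.
have [i vi] : exists i, v (chart_coord c i) != 0.
  apply: contrapT => h; apply: v0; apply: (tangent_coord_inj hc cp tv).
    exact: tangent0.
  by move=> i; apply/eqP/negPn/negP => ni; apply: h; exists i.
pose U' := U `&` cdom c; have oU' : open U' := openI oU oc.
have U'p : U' p by [].
have sx : smooth_on U' (chart_coord c i).
  by apply: smooth_on_sub (chart_coord_smooth i hc) => // q [].
pose Z q f := chart_coord c i q * Y q f.
have UU : U' `<=` U by exact: subIsetl.
have vY' := vfield_sub oU' UU vY.
have vZ : vfield_on U' Z by exact: vfieldZ sx vY'.
have brE : lie_bracket Y Z p = (fun f => v (chart_coord c i) * v f).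
  apply: (tangent_ext (p := p)); first exact: lie_bracket_tangent vY' vZ U'p.
    exact: tangentZ.
  move=> f sf; rewrite (lie_bracketE _ _ sf).
  have YE : Y p = v by rewrite vE.
  have tY : tangent p (Y p) by rewrite YE.
  rewrite {1 2}/Z (tangent_mul tY (smooth_on_near sx U'p)); last first.
    exact: vfield_smooth_near vY' U'p sf.
  by rewrite /Z YE; ring.
have sYZ : bracket_distr D D p (lie_bracket Y Z p).
  apply: lin_span_sub; exists U', Y, Z; split=> //.
    by split=> // q /UU; exact: sY.2.
  split=> // q /UU Uq; have [_ ->] := DX q Uq.
  exists (fun j => chart_coord c i q * a j); apply/funext => f.
  by rewrite /Z /Y /lincomb mulr_sumr; apply: eq_bigr => j _; rewrite mulrA.
have := @lin_span_lincomb _ 1 (fun=> (v (chart_coord c i))^-1) (fun=> lie_bracket Y Z p)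
  (fun=> sYZ).
congr (lin_span _ _); apply/funext => f.
by rewrite /lincomb big_ord_recl big_ord0 addr0 brE mulKf.
Qed.

Lemma bracket_distr_sub (D E F : distr M) p :
  (forall q k (a : 'I_k -> R) v, (forall i, F q (v i)) -> F q (lincomb a v)) ->
  (forall U X Y, U p -> section_on U D X -> section_on U E Y -> F p (lie_bracket X Y p)) ->
  bracket_distr D E p `<=` F p.
Proof.
move=> Fl FB v [k [a [w [Sw ->]]]]; apply: Fl => i.
by have [U [X [Y [Up sX sY ->]]]] := Sw i; exact: FB sX sY.
Qed.

End Extension.

Section ContactFrame.
Context (R : realType) (V : manifold R 3) (dvol : form3 V) (xi : distr V)
  (W : V -> oper V).
Context (vol : volume_form dvol) (xi_contact : contact_structure xi)
  (W_smooth : vfield_on setT W) (W0 : forall x, W x <> ozero V)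
  (W_leg : forall x, xi x (W x)).

(** In the frame e, the only components of a and da that contribute to a /\ da
are a(e2) and da(e0, e1), because e0 and e1 lie in the kernel of a. Hence da(e0,
e1) = - a([e0, e1]) cannot vanish. *)
Lemma contact_bracket_neq0 U (a : form1 V) (e : 'I_3 -> V -> oper V) q :
  is_form1_on U a -> (forall i, vfield_on U (e i)) -> U q ->
  independent (e ^~ q) ->
  (forall x, U x -> a x (e o0 x) = 0) -> (forall x, U x -> a x (e o1 x) = 0) ->
  (exists (B : set V) (X Y Z : V -> oper V),
    [/\ B q, B `<=` U, [/\ vfield_on B X, vfield_on B Y & vfield_on B Z] &
        wedge_ad a X Y Z q != 0]) ->
  a q (lie_bracket (e o0) (e o1) q) != 0.
Proof.
move=> fa ve Uq ie a0 a1 [B [X [Y [Z [Bq BU [vX vY vZ] wn]]]]].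
have [oU la sa] := fa; have [oB tX _] := vX.
have [B' [oB' B'q] [B'U coef]] := frame_coef ve Uq oU ie.
pose D := B `&` B'; have oD : open D := openI oB oB'.
have Dq : D q by []. have DB : D `<=` B by exact: subIsetl.
have DB' : D `<=` B' by exact: subIsetr.
have DU : D `<=` U by move=> x /DB/BU.
have fD : is_form1_on D a.
  split=> // [x /DU/la//|C T CD vT]; apply: sa vT => x /CD/DU //.
have vD T : vfield_on B T -> vfield_on D T by exact: vfield_sub.
have veD i : vfield_on D (e i) by exact: vfield_sub (ve i).
have [cx [sx xE]] := coef D X DB' (vD _ vX).
have [cy [sy yE]] := coef D Y DB' (vD _ vY).
have [cz [sz zE]] := coef D Z DB' (vD _ vZ).
have te i : tangent q (e i q) by have [_ t _] := ve i; exact: t.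
have dE T1 T2 c1 c2 : vfield_on D T1 -> vfield_on D T2 ->
    (forall i, smooth_on D (c1 i)) -> (forall i, smooth_on D (c2 i)) ->
    (forall x, D x -> T1 x = lincomb (c1 ^~ x) (e ^~ x)) ->
    (forall x, D x -> T2 x = lincomb (c2 ^~ x) (e ^~ x)) ->
    ext_deriv1 a T1 T2 q =
      \sum_i c1 i q * \sum_j c2 j q * ext_deriv1 a (e i) (e j) q.
  move=> v1 v2 s1 s2 E1 E2; rewrite (ext_deriv1_lincomb fD v1 v2 veD s1 E1 Dq).
  apply: eq_bigr => i _; congr (_ * _).
  rewrite (ext_deriv1_anti fD (veD i) v2 Dq).
  rewrite (ext_deriv1_lincomb fD v2 (veD i) veD s2 E2 Dq) -sumrN.
  by apply: eq_bigr => j _; rewrite -mulrN -(ext_deriv1_anti fD (veD i) (veD j) Dq).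
have aE T c : (forall x, D x -> T x = lincomb (c ^~ x) (e ^~ x)) ->
    a q (T q) = c o2 q * a q (e o2 q).
  move=> TE; rewrite TE // (tlinear_lincomb _ (la _ Uq)) // sum3E.
  by rewrite a0 // a1 // !mulr0 !add0r.
apply: contra_neq wn => br0.
have d01 : ext_deriv1 a (e o0) (e o1) q = 0.
  have [_ t0 _] := ve o0; have [_ t1 _] := ve o1; rewrite /ext_deriv1 br0 subr0.
  rewrite (tangent_near (t0 _ Uq) oU Uq (g := fun=> 0)) //.
  rewrite (tangent_near (t1 _ Uq) oU Uq (g := fun=> 0)) //.
  by rewrite (tangent_cst _ (t0 _ Uq)) (tangent_cst _ (t1 _ Uq)) subr0.
have anti i j := ext_deriv1_anti fD (veD i) (veD j) Dq.
have diag i : ext_deriv1 a (e i) (e i) q = 0 by have := anti i i; lra.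
rewrite /wedge_ad (dE Y Z cy cz) ?(dE Z X cz cx) ?(dE X Y cx cy); try exact: vD; try by [].
rewrite (aE X cx) // (aE Y cy) // (aE Z cz) // !sum3E !diag d01.
rewrite (anti o1 o0) (anti o2 o0) (anti o2 o1) d01; ring.
Qed.

(** T is a field on which the contact form a is nonzero. Z comes from a vector
outside the span of W and T, corrected by a multiple of T to lie in the kernel
of a. Independence of W, Z and T at x spreads to a neighbourhood because dvol(W,
Z, T) is continuous. *)
Lemma contact_frame x : exists (B : set V) (Z T : V -> oper V),
  [/\ B x, vfield_on B Z, vfield_on B T,
     forall y, B y -> dvol y (W y) (Z y) (T y) != 0 &
     forall y, B y ->
       xi y = [set v | exists a : 'I_2 -> R,
                v = lincomb a (fun i => if i == ord0 then W y else Z y)] /\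
       ~ xi y (lie_bracket W Z y)].
Proof.
have [U [a [Ux fa xiE ct]]] := xi_contact x; have [oU la sa] := fa.
have aW y : U y -> a y (W y) = 0 by move=> Uy; have := W_leg y; rewrite xiE // => -[].
have tW y : tangent y (W y) by have [_ t _] := W_smooth; exact: t.
have [U1 [T [U1x U1U vT aT]]] : exists (U1 : set V) T,
    [/\ U1 x, U1 `<=` U, vfield_on U1 T & a x (T x) != 0].
  have [B [X [Y [Z [Bx BU [vX vY vZ] wn]]]]] := ct x Ux.
  have [aX|aX] := eqVneq (a x (X x)) 0; last by exists B, X.
  have [aY|aY] := eqVneq (a x (Y x)) 0; last by exists B, Y.
  have [aZ|aZ] := eqVneq (a x (Z x)) 0; last by exists B, Z.
  by move: wn; rewrite /wedge_ad aX aY aZ !mul0r !addr0 eqxx.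
have tTx : tangent x (T x) by have [_ t _] := vT; exact: t.
have tWT (i : 'I_2) : tangent x (if i == ord0 then W x else T x) by case: ifP.
have [w tw wn] := outside_span (isT : (2 < 3)%N) tWT.
have [U2 [Z0 [vZ0 U2x Z0x]]] := tangent_extends tw.
pose U3 := U1 `&` U2.
have [oU1 _ _] := vT; have [oU2 _ _] := vZ0.
have oU3 : open U3 := openI oU1 oU2. have U3x : U3 x by [].
have U31 : U3 `<=` U1 by exact: subIsetl.
have U32 : U3 `<=` U2 by exact: subIsetr.
have U3U : U3 `<=` U by move=> y /U31/U1U.
have vT3 := vfield_sub oU3 U31 vT. have vZ03 := vfield_sub oU3 U32 vZ0.
have sT : smooth_on U3 (fun y => a y (T y)) by exact: sa vT3.
have sZ0 : smooth_on U3 (fun y => a y (Z0 y)) by exact: sa vZ03.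
(* the T-component is subtracted so that Z lies in the kernel of a *)
pose Z y f := a y (T y) * Z0 y f + - a y (Z0 y) * T y f.
have vZ : vfield_on U3 Z.
  by apply: vfield_comb => //; apply: vfieldZ => //; exact: smooth_on_opp.
have [_ tT _] := vT3; have [_ tZ0 _] := vZ03; have [_ tZ _] := vZ.
have aZ y : U3 y -> a y (Z y) = 0.
  move=> U3y; have l := la _ (U3U _ U3y).
  by rewrite /Z l ?(tlinearZ _ l) //; [ring | exact: tT | exact: tZ0 | exact/tangentZ/tT].
have ind : independent (triple (W x) (Z x) (T x)).
  move=> b; rewrite lincomb_tripleE => b0.
  have l := la _ Ux.
  have : b o2 * a x (T x) = 0.
    rewrite -(tlinear0 l) -b0 l // ?(tlinearZ _ l) //; last first.
    - by apply: tangent_comb; [exact: tZ | exact: tangentZ].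
    rewrite l; [|exact: tZ|exact: tangentZ].
    by rewrite aW // aZ // (tlinearZ _ l) // !mulr0 !add0r.
  move/eqP; rewrite mulf_eq0 (negPf aT) orbF => /eqP b2.
  have b1 : b o1 = 0.
    apply: contrapT => /eqP b1; apply: (wn (fun i => if i == ord0
       then - b o0 / (b o1 * a x (T x)) else a x (Z0 x) / a x (T x))).
    apply/funext => f; rewrite /lincomb !big_ord_recl big_ord0 /= -Z0x.
    have := congr1 (@^~ f) b0; rewrite b2 /Z /ozero mul0r !addr0 => e.
    have {}e : b o1 * (a x (T x) * Z0 x f) =
       b o1 * (a x (Z0 x) * T x f) - b o0 * W x f by move: e; lra.
    apply: (mulfI aT); apply: (mulfI b1); rewrite e; field.
    by rewrite aT b1.
  have b00 : b o0 = 0.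
    apply: contrapT => /eqP b00; apply: (W0 (x := x)); apply/funext => f.
    have := congr1 (@^~ f) b0; rewrite b1 b2 /ozero !mul0r !addr0 => /eqP.
    by rewrite mulf_eq0 (negPf b00) => /eqP.
  case=> [[|[|[|//]]] i3]; [rewrite -[RHS]b00|rewrite -[RHS]b1|rewrite -[RHS]b2];
    by congr b; exact/val_inj.
have vx := independent_vol vol (tW x) (tZ _ U3x) (tT _ U3x) ind.
have vW3 : vfield_on U3 W by exact: vfield_sub W_smooth.
have sv : smooth_on U3 (fun y => dvol y (W y) (Z y) (T y)).
  by have [[_ _ s] _] := vol; exact: s.
have [B1 [oB1 B1x] [B1U vB]] := smooth_on_neq0 sv U3x vx.
have [B2 [oB2 B2x] [B2U aB]] := smooth_on_neq0 sT U3x aT.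
pose B := B1 `&` B2; have oB : open B := openI oB1 oB2.
have BU3 : B `<=` U3 by move=> y [/B1U].
have BU : B `<=` U by move=> y /BU3/U3U.
have vWB := vfield_sub oB BU3 vW3; have vZB := vfield_sub oB BU3 vZ.
have vTB := vfield_sub oB BU3 vT3.
exists B, Z, T; split=> // [y [/vB]//|y By].
have Uy := BU _ By; have U3y := BU3 _ By; have l := la _ Uy.
have indy : independent (triple (W y) (Z y) (T y)).
  apply: (vol_independent vol (tW y) (tZ _ U3y) (tT _ U3y)).
  by apply: vB; have [] := By.
have te : forall i, tangent y (triple (W y) (Z y) (T y) i).
  by apply: triple_ind; [exact: tW | exact: tZ | exact: tT].
have aTy : a y (T y) != 0 by apply: aB; have [] := By.
split.
  rewrite xiE //; apply/seteqP; split=> v /=.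
    move=> [tv av]; have [b vE] := frame_span te indy tv.
    have b2 : b o2 = 0.
      move: av; rewrite vE (tlinear_lincomb _ l) // sum3E /triple /=.
      rewrite aW // aZ // !mulr0 !add0r => /eqP.
      by rewrite mulf_eq0 (negPf aTy) orbF => /eqP.
    exists (fun i => if i == ord0 then b o0 else b o1).
    rewrite vE lincomb_tripleE b2; apply/funext => f.
    by rewrite /lincomb !big_ord_recl big_ord0 /= mul0r !addr0.
  have tWZ (i : 'I_2) : tangent y (if i == ord0 then W y else Z y).
    by case: ifP => _ //; exact: tZ.
  move=> [b ->]; split; first exact: tangent_lincomb.
  rewrite (tlinear_lincomb _ l) // big1 // => i _.
  by case: ifP => _; rewrite ?aW ?aZ ?mulr0.
have fB : is_form1_on B a.
  by split=> // [z /BU/la//|C X CB vX]; apply: sa vX => z /CB/BU.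
have ve : forall i, vfield_on B (triple W Z T i) by exact: triple_ind.
have ey : (fun i => triple W Z T i y) = triple (W y) (Z y) (T y).
  by apply/funext => i; rewrite /triple; do 2![case: ifP => _ //].
rewrite xiE // => -[_ /eqP]; apply/negP.
apply: (@contact_bracket_neq0 B a (triple W Z T) y fB ve By).
- by rewrite ey.
- by move=> z /BU; exact: aW.
- by move=> z /BU3; exact: aZ.
have [C [X1 [X2 [X3 [Cy CU [v1 v2 v3] wn0]]]]] := ct y Uy.
have [oC _ _] := v1.
have oCB : open (C `&` B) := openI oC oB.
exists (C `&` B), X1, X2, X3; split=> //.
split.
- exact: vfield_sub oCB (@subIsetl _ _ _) v1.
- exact: vfield_sub oCB (@subIsetl _ _ _) v2.
- exact: vfield_sub oCB (@subIsetl _ _ _) v3.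
Qed.

End ContactFrame.

(** * The Engel structure of the lifted contact planes *)

Section EngelStructure.
Context (R : realType) (V : manifold R 3) (dvol : form3 V) (xi : distr V)
  (W : V -> oper V) (M : manifold R 4) (prj : M -> V) (rho : R -> M -> M)
  (A : form1 M).
Context (vol : volume_form dvol) (xi_contact : contact_structure xi)
  (W_smooth : vfield_on setT W) (W0 : forall x, W x <> ozero V)
  (W_leg : forall x, xi x (W x)).
Context (bundle : principal_circle_bundle prj rho) (conn : connection_form rho A)
  (curv : curvature_form prj A (fun x v w => pi *+ 2 * contraction3 W dvol x v w)).

Let prj_smooth : smooth_map_on setT prj. Proof. by have [] := bundle. Qed.
Let linA p : tlinear p (A p). Proof. by have [[_ l _] _ _] := conn; exact: l. Qed.
Let tW x : tangent x (W x). Proof. by have [_ t _] := W_smooth; exact: t. Qed.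

Let D := horizontal_lift prj A xi.
Let H := horizontal A.

Lemma is_distribution_contact : is_distribution 2 xi.
Proof.
move=> x; have [B [Z [T [Bx vZ vT vn xiE]]]] :=
  contact_frame vol xi_contact W_smooth W0 W_leg x.
have [oB tZ _] := vZ; have [_ tT _] := vT.
exists B, (fun (i : 'I_2) => if i == ord0 then W else Z); split=> // [i|y By].
  by case: ifP => _ //; exact: vfield_sub W_smooth.
split; last first.
  have [-> _] := xiE y By; apply/seteqP.
  by split=> v [a ->]; exists a; congr lincomb; apply/funext => i; case: ifP.
move=> a a0; have ind := vol_independent vol (tW y) (tZ _ By) (tT _ By) (vn y By).
have a00 := ind (triple (a ord0) (a (lift ord0 ord0)) 0).
have z : lincomb (triple (a ord0) (a (lift ord0 ord0)) 0)
    (triple (W y) (Z y) (T y)) = ozero V.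
  rewrite -a0 lincomb_tripleE; apply/funext => f.
  by rewrite /lincomb !big_ord_recl big_ord0 /= mul0r.
have h0 := a00 z o0; have h1 := a00 z o1.
by case=> [[|[|//]] i2]; [rewrite -[RHS]h0|rewrite -[RHS]h1];
  rewrite /triple /=; congr a; exact/val_inj.
Qed.

Lemma horizontalE : H = horizontal_lift prj A (@tangent R 3 V).
Proof.
apply/funext => p; apply/seteqP; split=> v [tv Av]; last by [].
by split=> //; exact: pushforward_tangent prj_smooth I tv.
Qed.

Lemma is_distribution_horizontal : is_distribution 3 H.
Proof.
rewrite horizontalE; apply: (horizontal_lift_distribution bundle conn).
exact: is_distribution_tangent.
Qed.

Lemma connection_bracket_vol U X Y p : section_on U H X -> section_on U H Y -> U p ->
  A p (lie_bracket X Y p) =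
  - (pi *+ 2 * dvol (prj p) (W (prj p)) (pushforward prj p (X p))
      (pushforward prj p (Y p))).
Proof. by move=> sX sY Up; rewrite (connection_bracket curv sX sY Up). Qed.

(** The vectors W, u and v lie in the plane xi, so they are dependent. *)
Lemma vol_contact_eq0 x u v : xi x u -> xi x v -> dvol x (W x) u v = 0.
Proof.
have [B [Z [T [Bx vZ vT vn xiE]]]] :=
  contact_frame vol xi_contact W_smooth W0 W_leg x.
have [_ tZ _] := vZ; have tZx := tZ _ Bx.
have [-> _] := xiE x Bx => -[a ->] [b ->].
have te (i : 'I_2) : tangent x (if i == ord0 then W x else Z x) by case: ifP.
have tu := tangent_lincomb a te.
have [_ _ l3] := vol_linear vol (tW x) tu.
rewrite (tlinear_lincomb _ l3 te) big1 // => j _.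
have [_ l2 _] := vol_linear vol (tW x) (te j).
rewrite (tlinear_lincomb _ l2 te) big1 ?mulr0 // => i _.
have [z1 z2 z3] := vol_alternating vol (tW x) tZx.
have [z4 _ _] := vol_alternating vol (tW x) (tW x).
by case: ifP => _; case: ifP => _; rewrite ?z1 ?z2 ?z3 ?z4 mulr0.
Qed.

Lemma bracket_horizontal U X Y p : section_on U H X -> section_on U H Y -> U p ->
  dvol (prj p) (W (prj p)) (pushforward prj p (X p)) (pushforward prj p (Y p)) = 0 ->
  H p (lie_bracket X Y p).
Proof.
move=> sX sY Up z; split; first exact: lie_bracket_tangent sX.1 sY.1 Up.
by rewrite (connection_bracket_vol sX sY Up) z mulr0 oppr0.
Qed.

Lemma section_lift_horizontal (F : distr V) U X :
  section_on U (horizontal_lift prj A F) X -> section_on U H X.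
Proof. by move=> [vX hX]; split=> // q /hX[]. Qed.

(** The local data used below: fields W', Z' and T' lifting W, Z and T. The
triple W, Z, [W, Z] is a frame as well, by the contact condition. *)
Lemma adapted_frame p : exists U (Z T : V -> oper V) (W' Z' T' : M -> oper M),
  [/\ U p, section_on U H W', section_on U H Z', section_on U H T' &
    forall q, U q -> let x := prj q in
      [/\ [/\ pushforward prj q (W' q) = W x, pushforward prj q (Z' q) = Z x &
            pushforward prj q (T' q) = T x],
          [/\ tangent x (Z x), tangent x (T x) & dvol x (W x) (Z x) (T x) != 0],
          xi x (Z x),
          pushforward prj q (lie_bracket W' Z' q) = lie_bracket W Z x &
          independent (triple (W x) (Z x) (lie_bracket W Z x)) ]].
Proof.
have [B [Z [T [Bx vZ vT vn xiE]]]] :=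
  contact_frame vol xi_contact W_smooth W0 W_leg (prj p).
have [oB tZ _] := vZ; have [_ tT _] := vT.
have vW : vfield_on B W by exact: vfield_sub W_smooth.
have [U [oU Up UB lift]] := horizontal_lift_vfield bundle conn oB Bx.
have [W' [vW' hW']] := lift _ vW.
have [Z' [vZ' hZ']] := lift _ vZ.
have [T' [vT' hT']] := lift _ vT.
have sU : smooth_map_on U prj.
  move=> C f sf; have := prj_smooth sf; rewrite setTI => sfp.
  exact: smooth_on_sub (openI oU sfp.1) (@subIsetr _ _ _) sfp.
exists U, Z, T, W', Z', T'; split=> //.
- by split=> // q /hW'[].
- by split=> // q /hZ'[].
- by split=> // q /hT'[].
move=> q Uq x; have Bq := UB _ Uq; have [xE bn] := xiE x Bq.
have [_ pW] := hW' q Uq; have [_ pZ] := hZ' q Uq; have [_ pT] := hT' q Uq.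
split=> //.
- by split; [exact: tZ | exact: tT | exact: vn].
- rewrite xE; exists (fun i => if i == ord0 then 0 else 1); apply/funext => f.
  by rewrite /lincomb !big_ord_recl big_ord0 /= mul0r mul1r add0r addr0.
- by apply: (pushforward_lie_bracket sU vW' vZ' vW vZ UB) => // r; [case/hW'|case/hZ'].
have ind := vol_independent vol (tW x) (tZ _ Bq) (tT _ Bq) (vn x Bq).
move=> a; rewrite lincomb_tripleE => a0.
have a2 : a o2 = 0.
  apply: contrapT => /eqP a2; apply: bn; rewrite xE.
  exists (fun i => if i == ord0 then - a o0 / a o2 else - a o1 / a o2).
  apply/funext => f; rewrite /lincomb !big_ord_recl big_ord0 /=.
  have := congr1 (@^~ f) a0; rewrite /ozero => e.
  have {}e : a o2 * lie_bracket W Z x f = - a o0 * W x f - a o1 * Z x f by move: e; lra.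
  by apply: (mulfI a2); rewrite e; field.
have z : lincomb (triple (a o0) (a o1) 0) (triple (W x) (Z x) (T x)) = ozero V.
  rewrite -a0 lincomb_tripleE a2; apply/funext => f.
  by rewrite /triple /= !mul0r.
have h0 := ind _ z o0; have h1 := ind _ z o1.
by case=> [[|[|[|//]]] i3]; [rewrite -[RHS]h0|rewrite -[RHS]h1|rewrite -[RHS]a2];
  rewrite /triple /=; congr a; exact/val_inj.
Qed.

Lemma is_distribution_engel : is_distribution 2 D.
Proof. exact: (horizontal_lift_distribution bundle conn is_distribution_contact). Qed.

(** Brackets of sections of D are horizontal since dvol(W, ., .) vanishes on xi.
Conversely a horizontal vector is the lift of its projection, which is a
combination of W, Z and [W, Z]; these lift to W', Z' and [W', Z']. *)
Lemma bracket_engel : bracket_distr D D = H.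
Proof.
apply/funext => p; apply/seteqP; split.
  apply: bracket_distr_sub => [q k a v|U X Y Up sX sY].
    exact: (horizontal_lincomb conn).
  apply: (bracket_horizontal (section_lift_horizontal sX) (section_lift_horizontal sY) Up).
  by apply: vol_contact_eq0; [have [] := sX.2 _ Up | have [] := sY.2 _ Up].
move=> v hv.
have [U [Z [T [W' [Z' [T' [Up sW sZ sT fr]]]]]]] := adapted_frame p.
have [[pW pZ pT] [tZ tT vn] xZ pB ind] := fr p Up.
have sDW : section_on U D W'.
  split=> [|q Uq]; first exact: sW.1.
  have [[e _ _] _ _ _ _] := fr q Uq; split; first exact: sW.2.
  by rewrite /= e.
have sDZ : section_on U D Z'.
  split=> [|q Uq]; first exact: sZ.1.
  have [[_ e _] _ xZq _ _] := fr q Uq; split; first exact: sZ.2.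
  by rewrite /= e.
have hb : H p (lie_bracket W' Z' p).
  apply: bracket_horizontal sW sZ Up _; rewrite pW pZ.
  exact: vol_contact_eq0.
have tB : tangent (prj p) (lie_bracket W Z (prj p)).
  by rewrite -pB; apply: pushforward_tangent prj_smooth I hb.1.
have te : forall i, tangent (prj p) (triple (W (prj p)) (Z (prj p))
    (lie_bracket W Z (prj p)) i) by exact: triple_ind.
have [a vE] := frame_span te ind (pushforward_tangent prj_smooth I hv.1).
have -> : v = lincomb a (triple (W' p) (Z' p) (lie_bracket W' Z' p)).
  apply: (horizontal_inj bundle conn hv).
    by apply: (horizontal_lincomb conn); apply: triple_ind;
      [exact: sW.2 | exact: sZ.2 | exact: hb].
  rewrite vE pushforward_lincomb; congr lincomb; apply/funext => i.
  by rewrite -pW -pZ -pB /triple; do 2![case: ifP => _ //].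
apply: lin_span_lincomb; apply: triple_ind.
- by apply: (subset_bracket_distr is_distribution_engel); exact: sDW.2.
- by apply: (subset_bracket_distr is_distribution_engel); exact: sDZ.2.
by apply: lin_span_sub; exists U, W', Z'.
Qed.

(** The bracket [Z', T'] is transverse to H because A takes the nonzero value -
2 pi dvol(W, Z, T) on it; together with H it spans the tangent space. *)
Lemma bracket_horizontal_tangent p : bracket_distr H H p = tangent p.
Proof.
apply/seteqP; split.
  apply: bracket_distr_sub => [q k a v|U X Y Up sX sY]; first exact: tangent_lincomb.
  exact: lie_bracket_tangent sX.1 sY.1 Up.
move=> v tv.
have [U [Z [T [W' [Z' [T' [Up sW sZ sT fr]]]]]]] := adapted_frame p.
have [[pW pZ pT] [tZ tT vn] xZ pB ind] := fr p Up.
pose w := lie_bracket Z' T' p.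
have tw : tangent p w by exact: lie_bracket_tangent sZ.1 sT.1 Up.
have Aw : A p w != 0.
  rewrite (connection_bracket_vol sZ sT Up) pZ pT oppr_eq0 mulf_neq0 //.
  by rewrite mulrn_eq0 /= gt_eqF // pi_gt0.
(* c is chosen so that v - c w is horizontal *)
pose c := A p v / A p w.
have hu : H p (fun f => - c * w f + v f).
  split; first exact: tangent_comb.
  by rewrite linA // /c; field.
have Bu := subset_bracket_distr is_distribution_horizontal hu.
have Bw : bracket_distr H H p w by apply: lin_span_sub; exists U, Z', T'.
have -> : v = lincomb (fun i : 'I_2 => if i == ord0 then c else 1)
    (fun i => if i == ord0 then w else (fun f => - c * w f + v f)).
  by apply/funext => f; rewrite /lincomb !big_ord_recl big_ord0 /=; ring.
by apply: lin_span_lincomb => i; case: ifP.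
Qed.

Let lift_W := horizontal_lift prj A (line_field W).

(** A section of the lifted line field projects to multiples of W, and dvol(W,
W, .) = 0. *)
Lemma cauchy_characteristic_lift : cauchy_characteristic H lift_W.
Proof.
split.
- apply: (horizontal_lift_distribution bundle conn).
  exact: is_distribution_line_field.
- by move=> p v [].
move=> p; apply: bracket_distr_sub => [q k a v|U X Y Up sX sY].
  exact: (horizontal_lincomb conn).
apply: (bracket_horizontal (section_lift_horizontal sX) sY Up).
have [_ [c ->]] := sX.2 _ Up.
have tY : tangent (prj p) (pushforward prj p (Y p)).
  exact: pushforward_tangent prj_smooth I (sY.2 _ Up).1.
have [_ l _] := vol_linear vol (tW (prj p)) tY.
rewrite (tlinearZ _ l) //; have [-> _ _] := vol_alternating vol (tW (prj p)) tY.
by rewrite mulr0.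
Qed.

(** Let X be a section of L, and b0, b1, b2 the components of its projection in
the frame W, Z, T. The brackets of X with T' and Z' are horizontal, so dvol(W,
X, T) and dvol(W, X, Z) vanish; these are b1 and - b2 times dvol(W, Z, T). *)
Lemma cauchy_characteristic_sub L : cauchy_characteristic H L ->
  forall p v, L p v -> lift_W p v.
Proof.
move=> [dL LH LB] p v Lv; split; first exact: LH.
have [U [X [Up vX LX]]] := dL p.
have [_ LE] := LX p Up.
move: Lv; rewrite LE => -[a vE].
pose x := prj p.
suff [c cE] : line_field W x (pushforward prj p (X ord0 p)).
  exists (a ord0 * c); rewrite vE pushforward_lincomb; apply/funext => f.
  by rewrite /lincomb big_ord_recl big_ord0 addr0 cE mulrA.
have sL : section_on U L (X ord0).
  split=> // q Uq; have [_ ->] := LX q Uq; exists (fun=> 1).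
  by apply/funext => f; rewrite /lincomb big_ord_recl big_ord0 addr0 mul1r.
have [U' [Z [T [W' [Z' [T' [U'p sW sZ sT fr]]]]]]] := adapted_frame p.
have [[pW pZ pT] [tZ tT vn] xZ pB ind] := fr p U'p.
have [oU _ _] := vX ord0; have [oU' _ _] := sW.1.
have oUU := openI oU oU'.
have sub F B X1 : section_on B F X1 -> U `&` U' `<=` B -> section_on (U `&` U') F X1.
  by move=> [v1 h1] s; split; [exact: vfield_sub oUU s v1 | move=> q /s; exact: h1].
have sLH : section_on U H (X ord0) by split; [exact: sL.1 | move=> q /sL.2/LH].
have tX : tangent x (pushforward prj p (X ord0 p)).
  exact: pushforward_tangent prj_smooth I (sLH.2 _ Up).1.
have key Y : section_on U' H Y ->
    dvol x (W x) (pushforward prj p (X ord0 p)) (pushforward prj p (Y p)) = 0.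
  move=> sY; have UUp : (U `&` U') p by [].
  have [_ ] : H p (lie_bracket (X ord0) Y p).
    apply: LB; apply: lin_span_sub; exists (U `&` U'), (X ord0), Y; split=> //.
      exact: (sub _ _ _ sL (@subIsetl _ _ _)).
    exact: (sub _ _ _ sY (@subIsetr _ _ _)).
  rewrite (connection_bracket_vol (sub _ _ _ sLH (@subIsetl _ _ _))
    (sub _ _ _ sY (@subIsetr _ _ _)) UUp) => /eqP.
  by rewrite oppr_eq0 mulf_eq0 mulrn_eq0 /= gt_eqF ?pi_gt0 //= => /eqP.
have kZ := key _ sZ; have kT := key _ sT; rewrite pZ in kZ; rewrite pT in kT.
have te : forall i, tangent x (triple (W x) (Z x) (T x) i) by exact: triple_ind.
have indT := vol_independent vol (tW x) tZ tT vn.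
have [b bE] := frame_span te indT tX.
have [_ lZ _] := vol_linear vol (tW x) tZ; have [_ lT _] := vol_linear vol (tW x) tT.
have [z1 z2 _] := vol_alternating vol (tW x) tZ.
have [z3 z4 _] := vol_alternating vol (tW x) tT.
have [s1 s2] := vol_swap vol (tW x) tZ tT.
have b1 : b o1 = 0.
  move: kT; rewrite bE (tlinear_lincomb _ lT te) sum3E /triple /= z3 z4.
  by rewrite !mulr0 addr0 add0r => /eqP; rewrite mulf_eq0 (negPf vn) orbF => /eqP.
have b2 : b o2 = 0.
  move: kZ; rewrite bE (tlinear_lincomb _ lZ te) sum3E /triple /= z1 z2 s2.
  by rewrite !mulr0 !add0r => /eqP; rewrite mulf_eq0 oppr_eq0 (negPf vn) orbF => /eqP.
exists (b o0); rewrite bE lincomb_tripleE b1 b2; apply/funext => f.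
by rewrite !mul0r !addr0.
Qed.

(** The remaining inclusion is equality of two lines: both are one-dimensional.
*)
Lemma cauchy_characteristicP L :
  cauchy_characteristic H L <-> forall p, L p = lift_W p.
Proof.
split=> [cL p|LW]; last first.
  by rewrite (_ : L = lift_W); [exact: cauchy_characteristic_lift | exact/funext].
have sub := cauchy_characteristic_sub cL; have [dL _ _] := cL.
apply/seteqP; split=> v; first exact: sub.
move=> [hv [c cE]]; have [U [X [Up vX LX]]] := dL p; have [iX LE] := LX p Up.
have LXp : L p (X ord0 p).
  rewrite LE; exists (fun=> 1); apply/funext => f.
  by rewrite /lincomb big_ord_recl big_ord0 addr0 mul1r.
have [hX [b bE]] := sub _ _ LXp.
have b0 : b != 0.
  apply/eqP => b0; have /(_ (fun=> 1)) := iX.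
  suff -> : lincomb (fun=> 1) (X ^~ p) = ozero M.
    by move=> /(_ erefl ord0)/eqP; rewrite oner_eq0.
  have -> : lincomb (fun=> 1) (X ^~ p) = X ord0 p.
    by apply/funext => f; rewrite /lincomb big_ord_recl big_ord0 addr0 mul1r.
  apply: (horizontal_inj bundle conn hX).
    by split; [exact: tangent0 | exact: tlinear0 (@linA p)].
  rewrite bE b0; apply/funext => f; rewrite mul0r /pushforward /germ_oper.
  by case: ifP.
rewrite LE; exists (fun=> c / b).
apply: (horizontal_inj bundle conn hv).
  apply: (horizontal_lincomb conn) => i; by rewrite (ord1 i).
rewrite cE pushforward_lincomb; apply/funext => f.
by rewrite /lincomb big_ord_recl big_ord0 addr0 bE mulrA divfK.
Qed.

End EngelStructure.

Theorem theorem1p9 (R : realType) (V : manifold R 3) (dvol : form3 V)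
    (xi : distr V) (W : V -> oper V) (M : manifold R 4) (prj : M -> V)
    (rho : R -> M -> M) (A : form1 M)
    (dvol_volume : volume_form dvol)
    (xi_contact : contact_structure xi)
    (W_smooth : vfield_on setT W)
    (W_nonvanishing : forall x, W x <> ozero V)
    (W_legendrian : forall x, xi x (W x))
    (W_preserves : preserves_form3 W dvol)
    (omega_integral : integral_form (contraction3 W dvol))
    (M_prequantum : prequantum_bundle prj rho A (contraction3 W dvol)) :
  let D := horizontal_lift prj A xi in
  let E := bracket_distr D D in
  engel D /\
  (forall m, E m = horizontal A m) /\
  (forall L : distr M, cauchy_characteristic E L <->
     (forall m, L m = horizontal_lift prj A (line_field W) m)).
Proof.
have [bundle [_ [conn curv]]] := M_prequantum; move=> D E.
have EH : E = horizontal A by exact: (bracket_engel (rho := rho) (dvol := dvol) (W := W)).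
split; last split.
- split; rewrite -/E ?EH.
  + exact: (is_distribution_engel (rho := rho) (dvol := dvol) (W := W)).
  + exact: (is_distribution_horizontal bundle conn).
  + exact: (bracket_horizontal_tangent dvol_volume xi_contact W_smooth
      W_nonvanishing W_legendrian bundle conn curv).
- by move=> m; rewrite EH.
- move=> L; rewrite EH.
  exact: (cauchy_characteristicP dvol_volume xi_contact W_smooth
      W_nonvanishing W_legendrian bundle conn curv).
Qed.
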